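(* Let $\mathfrak g=\mathfrak{osp}(1\vert2)$ and $\mathfrak g_0=\mathfrak{sl}(2)$. The parafermion vertex algebra $N_{-3/2}(\mathfrak g)$ is generated by $N_{-3/2}(\mathfrak g_0)$ and three primary vectors $Z_{2,0},Z_{2,1},Z_{2,2}$ of conformal weight $4$.
   Context: Everything is over $\mathbb C$. $\mathfrak{osp}(1\vert2)$ has even part $\mathfrak g_0=\mathrm{span}\{e,f,h\}\cong\mathfrak{sl}(2)$, odd part $\mathrm{span}\{x,y\}$, relations $[e,f]=h$, $[h,e]=2e$, $[h,f]=-2f$, $[h,x]=x$, $[e,x]=0$, $[f,x]=-y$, $[h,y]=-y$, $[e,y]=-x$, $[f,y]=0$, $\{x,x\}=2e$, $\{x,y\}=h$, $\{y,y\}=-2f$, and form $(e,f)=(f,e)=1$, $(h,h)=2$, $(x,y)=-(y,x)=2$. $L_k(\mathfrak g)$ is the unique simple (graded) quotient of the universal affine vertex superalgebra $V^k(\mathfrak g)$. At $k=-3/2$ the even part generates a copy of $L_{-3/2}(\mathfrak g_0)$ in $L_{-3/2}(\mathfrak g)$. $N_k(\mathfrak g)=\{v\in L_k(\mathfrak g)\mid h(n)v=0\ \forall n\in\mathbb Z_{\ge0}\}$, $N_k(\mathfrak g_0)=\{v\in L_k(\mathfrak g_0)\mid h(n)v=0\ \forall n\in\mathbb Z_{\ge0}\}$. Primary and conformal weight refer to the Virasoro vector of $N_{-3/2}(\mathfrak g_0)$, namely $\omega_{sug}-\frac1{4k}h(-1)^2{\bf 1}$ with $k=-\frac32$, where $\omega_{sug}=(e(-1)f(-1)+f(-1)e(-1)+\frac12h(-1)^2){\bf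 1}$ (on $N_{-3/2}(\mathfrak g)$ this gives the same action as $\omega_{sug}$). *)

(* Defs.v *)
(* MathComp, with classical sets from MathComp-Analysis. *)
From HB Require Import structures.
From mathcomp Require Import all_boot all_order all_algebra.
From mathcomp Require Import complex.
From mathcomp Require Import boolp classical_sets reals.

Set Implicit Arguments.
Unset Strict Implicit.
Unset Printing Implicit Defensive.

Import Order.TTheory GRing.Theory Num.Theory.
Local Open Scope classical_set_scope.
Local Open Scope ring_scope.

(** * Vertex superalgebras *)

(* m (m - 1) ... (m - j + 1) / j!, for m an integer of any sign *)
Definition binz (F : numFieldType) (m : int) (j : nat) : F :=
  (\prod_(i < j) (m%:~R - i%:R)) / j`!%:R.

(* [homog false] and [homog true] are the even and the odd part; [nprod a n b]
   is a_(n) b, where Y(a, z) = \sum_n a_(n) z^(-n-1).  Both sums of the Borcherds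
   identity are finite by [vs_truncation], so it is stated for all sufficiently
   large cut-offs N.  The translation operator is a |-> a_(-2) 1. *)
Record vertexSuperalgebra (F : numFieldType) : Type := VertexSuperalgebra {
  vs_sort :> lmodType F;
  homog : bool -> set vs_sort;
  vac : vs_sort;
  nprod : vs_sort -> int -> vs_sort -> vs_sort;
  vs_homog0 : forall p, homog p 0;
  vs_homog_lin : forall p (c : F) u v,
    homog p u -> homog p v -> homog p (c *: u + v);
  vs_homog_split : forall v, exists v0 v1,
    [/\ homog false v0, homog true v1 & v = v0 + v1];
  vs_homog_disj : forall v, homog false v -> homog true v -> v = 0;
  vs_homog_vac : homog false vac;
  vs_homog_nprod : forall p q a b n,
    homog p a -> homog q b -> homog (p (+) q) (nprod a n b);
  vs_linl : forall (c : F) a a' n b,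
    nprod (c *: a + a') n b = c *: nprod a n b + nprod a' n b;
  vs_linr : forall (c : F) a n b b',
    nprod a n (c *: b + b') = c *: nprod a n b + nprod a n b';
  vs_truncation : forall a b, exists N : int, forall n, N <= n -> nprod a n b = 0;
  vs_vacl : forall n a, nprod vac n a = if n == -1 then a else 0;
  vs_vacr : forall a, nprod a (-1) vac = a;
  vs_vacr0 : forall a (n : nat), nprod a n%:Z vac = 0;
  vs_borcherds : forall p q a b c (m n l : int), homog p a -> homog q b ->
    exists N0 : nat, forall N : nat, (N0 <= N)%N ->
      \sum_(j < N) binz F m j *: nprod (nprod a (n + j%:Z) b) (m + l - j%:Z) c
      = \sum_(j < N) ((-1) ^+ j * binz F n j) *:
          (nprod a (m + n - j%:Z) (nprod b (l + j%:Z) c)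
           - ((-1) ^ n * (-1) ^+ (p && q)) *:
               nprod b (n + l - j%:Z) (nprod a (m + j%:Z) c))
}.

Arguments homog {F _}.
Arguments vac {F _}.
Arguments nprod {F _}.



Section VertexSuperalgebras.
Variable F : numFieldType.
Implicit Types V W : vertexSuperalgebra F.

Definition subspace V (S : set V) : Prop :=
  S 0 /\ forall (c : F) u v, S u -> S v -> S (c *: u + v).

Definition vertex_subalgebra V (S : set V) : Prop :=
  [/\ subspace S, S vac & forall u n v, S u -> S v -> S (nprod u n v)].

Definition generated_by V (G : set V) : set V :=
  smallest (@vertex_subalgebra V) G.

Definition vertex_ideal V (I : set V) : Prop :=
  subspace I /\
  forall u n v, I v -> I (nprod u n v) /\ I (nprod v n u).

Definition vertex_hom V W (f : V -> W) : Prop :=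
  [/\ forall (c : F) u v, f (c *: u + v) = c *: f u + f v,
      f vac = vac,
      forall p u, homog p u -> homog p (f u)
    & forall u n v, f (nprod u n v) = nprod (f u) n (f v)].

End VertexSuperalgebras.

(** * Affine vertex superalgebras *)

(* A Lie superalgebra with a bilinear form, given in a basis of homogeneous
   elements; [lie_br a b] lists the nonzero coordinates of [a, b]. *)
Record lieSuperData (F : numFieldType) : Type := LieSuperData {
  lie_basis :> Type;
  lie_odd : lie_basis -> bool;
  lie_br : lie_basis -> lie_basis -> seq (F * lie_basis);
  lie_form : lie_basis -> lie_basis -> F
}.

Section Affine.
Variables (F : numFieldType) (g : lieSuperData F).
Implicit Types V W L : vertexSuperalgebra F.

(* [J a] stands for a(-1)1, so that [nprod (J a) n] is the mode a(n). *)
Definition affine_at_level (k : F) V (J : g -> V) : Prop :=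
  (forall a, homog (lie_odd a) (J a)) /\
  forall a b (n : nat),
    nprod (J a) n%:Z (J b) =
      match n with
      | 0%N => \sum_(t <- lie_br a b) t.1 *: J t.2
      | 1%N => (k * lie_form a b) *: vac
      | _ => 0
      end.

(* V^k(g) *)
Definition universal_affine (k : F) V (J : g -> V) : Prop :=
  [/\ affine_at_level k J,
      generated_by (range J) = setT
    & forall W (JW : g -> W), affine_at_level k JW ->
        exists f : V -> W, vertex_hom f /\ forall a, f (J a) = JW a].

(* [degree J d] is the span of the a1(m1)...ar(mr)1 with - (m1 + ... + mr) = d *)
Inductive degree V (J : g -> V) : int -> set V :=
| degree_vac : degree J 0 vac
| degree_mode a m d v : degree J d v -> degree J (d - m) (nprod (J a) m v)
| degree_zero d : degree J d 0
| degree_lin d (c : F) u v :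
    degree J d u -> degree J d v -> degree J d (c *: u + v).

Definition graded V (J : g -> V) (I : set V) : Prop :=
  forall v, I v -> exists2 s : seq V, v = \sum_(u <- s) u &
    forall u, u \in s ->
      [/\ I u, exists d, degree J d u & exists p, homog p u].

Definition graded_simple V (J : g -> V) : Prop :=
  (vac : V) <> 0 /\
  forall I : set V, vertex_ideal I -> graded J I -> I = [set 0] \/ I = setT.

(* L_k(g): a quotient of V^k(g) by a graded ideal, which is graded-simple *)
Definition simple_affine (k : F) L (J : g -> L) : Prop :=
  exists V (JV : g -> V) (f : V -> L),
    [/\ universal_affine k JV,
        vertex_hom f /\ (forall a, f (JV a) = J a),
        range f = setT,
        graded JV (f @^-1` [set 0])
      & graded_simple J].

End Affine.

(** * sl(2) and osp(1|2) *)

Inductive sl2_basis := sl2_e | sl2_f | sl2_h.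

Inductive osp12_basis := osp12_even of sl2_basis | osp12_x | osp12_y.

Section LieData.
Variable F : numFieldType.

Definition sl2_br (a b : sl2_basis) : seq (F * sl2_basis) :=
  match a, b with
  | sl2_e, sl2_f => [:: (1, sl2_h)]
  | sl2_f, sl2_e => [:: (-1, sl2_h)]
  | sl2_h, sl2_e => [:: (2, sl2_e)]
  | sl2_e, sl2_h => [:: (-2, sl2_e)]
  | sl2_h, sl2_f => [:: (-2, sl2_f)]
  | sl2_f, sl2_h => [:: (2, sl2_f)]
  | _, _ => [::]
  end.

Definition sl2_form (a b : sl2_basis) : F :=
  match a, b with
  | sl2_e, sl2_f | sl2_f, sl2_e => 1
  | sl2_h, sl2_h => 2
  | _, _ => 0
  end.

Definition sl2 : lieSuperData F :=
  LieSuperData (fun _ => false) sl2_br sl2_form.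

Definition osp12_odd (a : osp12_basis) : bool :=
  if a is osp12_even _ then false else true.

Definition osp12_br (a b : osp12_basis) : seq (F * osp12_basis) :=
  match a, b with
  | osp12_even a', osp12_even b' =>
      [seq (t.1, osp12_even t.2) | t <- sl2_br a' b']
  | osp12_even sl2_h, osp12_x => [:: (1, osp12_x)]
  | osp12_x, osp12_even sl2_h => [:: (-1, osp12_x)]
  | osp12_even sl2_f, osp12_x => [:: (-1, osp12_y)]
  | osp12_x, osp12_even sl2_f => [:: (1, osp12_y)]
  | osp12_even sl2_h, osp12_y => [:: (-1, osp12_y)]
  | osp12_y, osp12_even sl2_h => [:: (1, osp12_y)]
  | osp12_even sl2_e, osp12_y => [:: (-1, osp12_x)]
  | osp12_y, osp12_even sl2_e => [:: (1, osp12_x)]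
  | osp12_x, osp12_x => [:: (2, osp12_even sl2_e)]
  | osp12_x, osp12_y | osp12_y, osp12_x => [:: (1, osp12_even sl2_h)]
  | osp12_y, osp12_y => [:: (-2, osp12_even sl2_f)]
  | _, _ => [::]
  end.

Definition osp12_form (a b : osp12_basis) : F :=
  match a, b with
  | osp12_even a', osp12_even b' => sl2_form a' b'
  | osp12_x, osp12_y => 2
  | osp12_y, osp12_x => -2
  | _, _ => 0
  end.

Definition osp12 : lieSuperData F :=
  LieSuperData osp12_odd osp12_br osp12_form.

End LieData.

(** * Parafermion vertex algebras *)

Section Parafermion.
Variables (F : numFieldType) (V : vertexSuperalgebra F).

(* N_k, when V is L_k(g) and h is h(-1)1 *)
Definition parafermion (h : V) : set V :=
  [set v | forall n : nat, nprod h n%:Z v = 0].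

(* the Sugawara vector of sl(2) at the level -3/2, where 2 (k + 2) = 1 *)
Definition omega_sug (e f h : V) : V :=
  nprod e (-1) f + nprod f (-1) e + 2^-1 *: nprod h (-1) h.

Definition omega_parafermion (k : F) (e f h : V) : V :=
  omega_sug e f h - (4 * k)^-1 *: nprod h (-1) h.

(* L(n) = omega_(n + 1) *)
Definition primary (omega : V) (wt : F) (v : V) : Prop :=
  nprod omega 1 v = wt *: v /\
  forall n : nat, (0 < n)%N -> nprod omega n.+1%:Z v = 0.

Definition linearly_independent (n : nat) (Z : 'I_n -> V) : Prop :=
  forall c : 'I_n -> F, \sum_(i < n) c i *: Z i = 0 -> forall i, c i = 0.

End Parafermion.

(* Main.v *)
Require Import Defs.
From HB Require Import structures.
From mathcomp Require Import all_boot all_order all_algebra.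
From mathcomp Require Import complex.
From mathcomp Require Import boolp classical_sets reals.
From mathcomp Require Import zify ring.

Set Implicit Arguments.
Unset Strict Implicit.
Unset Printing Implicit Defensive.

Import Order.TTheory GRing.Theory Num.Theory.
Local Open Scope classical_set_scope.
Local Open Scope ring_scope.

(* The level -3/2 is critical for osp(1|2): the Sugawara vector S of osp(1|2) is
   singular, so S = 0 in L, and omega_sug is a combination of x(-1)y and Dh, where D is
   the translation operator.  On V0 = L_{-3/2}(sl(2)) the operator omega_sug_(0) is D,
   but on L the difference E = D - omega_sug_(0) is a nonzero derivation killing V0,
   hence commuting with the modes of V0.  Put x' = E x; then S = 0 gives E x' = 0.

   The vector s = x(-2)x + x(-1)x' is singular of weight 2 for affine sl(2), and so are
   E s and E^2 s = 2 x'(-2)x', while E^3 s = 0 and y(2)y(3)x'(-2)x' = 30 vac.  Thus the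
   Z_i = f(0) E^i s (i = 0, 1, 2) are independent, lie in N, and are primary of
   weight 4.

   From D x = h(-1)x - 2e(-1)y + x' and its analogues for y, x', y' one computes the
   products x(n)y recursively (a Knizhnik-Zamolodchikov recursion, which is solvable
   except at n = -2): they all lie in V0 + V0.Z_0 + V0.Z_1.  The h(0)-invariants of L are
   generated by h and the x(n)y; complete reducibility over the Heisenberg algebra shows
   that they are generated by h, N_0 and the Z_i, and removing h leaves N. *)

(** * Mode calculus *)

(** Degree and conformal weight disagree. As the level is critical, the Sugawara vector of osp(1|2)
    gives no grading of [L]; degrees are separated instead by an operator with eigenvalues [2 ^ d],
    obtained by applying universality to the rescaled fields Y(a, 2z). In contrast, [omega_(1)]
    gives a singular vector of spin j for affine sl(2) the weight j(j + 1)/(k + 2), where k + 2 =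
    1/2. This is 3/2 for x and y (degree 1) and for x' and y' (degree 2). The Z_i are the weight
    zero vectors of triplets, j = 1, so all three have weight 4, although E raises the degree by one
    and they sit in degrees 3, 4 and 5. The recursion runs down from the known products with n >= 0.
    Its coefficients are n + 2 for x(n)x and y(n)y and a 2 by 2 system of determinant n^2 - 4 for
    the mixed pair, so n = -2 is the only gap. There s supplies x(-2)x and E s supplies x'(-2)x.
    Explicit identities are decided by rewriting both sides into normally ordered words with
    rational coefficients; those that hold only modulo S = 0 come with the multiple of S as a
    witness. *)

Section Binomials.
Variable F : numFieldType.
Implicit Types m : int.

Lemma binz0 m : binz F m 0 = 1.
Proof. by rewrite /binz big_ord0 fact0 divr1. Qed.

Lemma binz1 m : binz F m 1 = m%:~R.
Proof. by rewrite /binz big_ord1 subr0 divr1. Qed.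

Lemma binz0S j : binz F 0 j.+1 = 0.
Proof. by rewrite /binz big_ord_recl subrr !mul0r. Qed.

Lemma binzS m j : binz F m j.+1 = binz F m j * (m%:~R - j%:R) / j.+1%:R.
Proof.
rewrite /binz big_ord_recr /= factS natrM invfM.
by rewrite [_.+1%:R^-1 * _]mulrC mulrACA mulrA.
Qed.

Lemma binzN1 j : (-1) ^+ j * binz F (-1) j = 1.
Proof.
elim: j => [|j IH]; first by rewrite binz0 mulr1.
rewrite -[RHS]IH binzS exprS.
have ? : (1 + j%:R : F) != 0 by rewrite addrC natr1 pnatr_eq0.
by rewrite -natr1; field; rewrite addrC.
Qed.

Lemma binzN2 j : (-1) ^+ j * binz F (-2) j = j.+1%:R.
Proof.
elim: j => [|j IH]; first by rewrite binz0 mulr1.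
have ? : (j%:R + 1 : F) != 0 by rewrite natr1 pnatr_eq0.
rewrite binzS exprS.
rewrite (_ : _ * _ = ((-1) ^+ j * binz F (-2) j) * (2 + j%:R) / j.+1%:R).
  by rewrite IH -!natr1; field.
by rewrite -natr1; field; rewrite addrC.
Qed.

End Binomials.

(** * Consequences of the Borcherds identity and the translation operator *)

Section Modes.
Variables (F : numFieldType) (V : vertexSuperalgebra F).
Implicit Types (a b c u v w : V) (n m l : int) (p q : bool) (S M : set V).

Lemma nprodDl a b n c : nprod (a + b) n c = nprod a n c + nprod b n c.
Proof. by have := vs_linl 1 a b n c; rewrite !scale1r. Qed.

Lemma nprodDr a n b c : nprod a n (b + c) = nprod a n b + nprod a n c.
Proof. by have := vs_linr 1 a n b c; rewrite !scale1r. Qed.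

Lemma nprod0l n b : nprod (0 : V) n b = 0.
Proof. by apply: (addrI (nprod 0 n b)); rewrite -nprodDl !addr0. Qed.

Lemma nprod0r a n : nprod a n 0 = 0.
Proof. by apply: (addrI (nprod a n 0)); rewrite -nprodDr !addr0. Qed.

Lemma nprodZl (k : F) a n b : nprod (k *: a) n b = k *: nprod a n b.
Proof. by have := vs_linl k a 0 n b; rewrite nprod0l !addr0. Qed.

Lemma nprodZr (k : F) a n b : nprod a n (k *: b) = k *: nprod a n b.
Proof. by have := vs_linr k a n b 0; rewrite nprod0r !addr0. Qed.

Lemma nprodNl a n b : nprod (- a) n b = - nprod a n b.
Proof. by rewrite -scaleN1r nprodZl scaleN1r. Qed.

Lemma nprodNr a n b : nprod a n (- b) = - nprod a n b.
Proof. by rewrite -scaleN1r nprodZr scaleN1r. Qed.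

Lemma nprodBl a b n c : nprod (a - b) n c = nprod a n c - nprod b n c.
Proof. by rewrite nprodDl nprodNl. Qed.

Lemma nprodBr a n b c : nprod a n (b - c) = nprod a n b - nprod a n c.
Proof. by rewrite nprodDr nprodNr. Qed.

Lemma nprod_suml (I : Type) (r : seq I) (P : pred I) (f : I -> V) n b :
  nprod (\sum_(i <- r | P i) f i) n b = \sum_(i <- r | P i) nprod (f i) n b.
Proof.
by apply: (big_morph (fun a => nprod a n b)) => [x y|];
  rewrite ?nprodDl ?nprod0l.
Qed.

Lemma nprod_sumr (I : Type) (r : seq I) (P : pred I) (f : I -> V) a n :
  nprod a n (\sum_(i <- r | P i) f i) = \sum_(i <- r | P i) nprod a n (f i).
Proof.
by apply: (big_morph (nprod a n)) => [x y|]; rewrite ?nprodDr ?nprod0r.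
Qed.

Lemma vs_vacN1 a : nprod vac (-1) a = a.
Proof. by rewrite vs_vacl eqxx. Qed.

Section SubspaceTheory.
Variables (S : set V) (hS : subspace S).

Lemma subsp0 : S 0. Proof. by case: hS. Qed.

Lemma subspZ (k : F) v : S v -> S (k *: v).
Proof. by case: hS => S0 Slin Sv; rewrite -[_ *: _]addr0; apply: Slin. Qed.

Lemma subspD u v : S u -> S v -> S (u + v).
Proof. by case: hS => S0 Slin Su Sv; rewrite -[u]scale1r; apply: Slin. Qed.

Lemma subspN v : S v -> S (- v).
Proof. by rewrite -scaleN1r; apply: subspZ. Qed.

Lemma subspB u v : S u -> S v -> S (u - v).
Proof. by move=> Su Sv; apply/subspD/subspN. Qed.

Lemma subsp_sum (I : Type) (r : seq I) (P : pred I) (f : I -> V) :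
  (forall i, P i -> S (f i)) -> S (\sum_(i <- r | P i) f i).
Proof. by move=> Sf; apply: (big_ind S) => //; [exact: subsp0|exact: subspD]. Qed.

Lemma subsp_sum_seq (s : seq V) :
  (forall u, u \in s -> S u) -> S (\sum_(u <- s) u).
Proof.
by move=> Ss; rewrite big_seq; apply: subsp_sum => u; apply: Ss.
Qed.

End SubspaceTheory.

Lemma subspace_homog p : subspace (@homog F V p).
Proof. by split=> [|k u v]; [exact: vs_homog0|exact: vs_homog_lin]. Qed.

Lemma sum_ord_trunc (f : nat -> V) (K N : nat) : (K <= N)%N ->
  (forall j, (K <= j)%N -> f j = 0) -> \sum_(j < N) f j = \sum_(j < K) f j.
Proof.
move=> KN f0; rewrite (big_ord_widen N f KN) [LHS](bigID (fun j : 'I_N => (j < K)%N)) /=.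
by rewrite addrC big1 ?add0r // => j; rewrite -leqNgt => /f0.
Qed.

Lemma sum_ord_1 N (f : 'I_N.+1 -> V) :
  (forall j : 'I_N, f (lift ord0 j) = 0) -> \sum_(j < N.+1) f j = f ord0.
Proof. by move=> f0; rewrite big_ord_recl big1 ?addr0 // => j _; apply: f0. Qed.

(** The Borcherds identity at [n = 0]: the binomials [binz F 0 j] kill every term on its right
    except [j = 0]. *)
Lemma super_commutator p q a b c m l : homog p a -> homog q b ->
  exists N0 : nat, forall N, (N0 <= N)%N ->
    nprod a m (nprod b l c) - (-1) ^+ (p && q) *: nprod b l (nprod a m c)
    = \sum_(j < N) binz F m j *: nprod (nprod a j%:Z b) (m + l - j%:Z) c.
Proof.
move=> pa qb; have [N0 H] := @vs_borcherds F V p q a b c m 0 l pa qb.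
exists N0.+1 => -[//|N] N0N; have {H} := H N.+1 (leqW N0N).
under eq_bigr do rewrite add0r; move=> ->.
rewrite sum_ord_1 => [|j]; last by rewrite binz0S mulr0 scale0r.
by rewrite /= binz0 mulr1 scale1r !(addr0, subr0, add0r) expr0z mul1r.
Qed.

Lemma super_commutator_trunc K p q a b c m l : homog p a -> homog q b ->
  (forall j : nat, (K <= j)%N -> nprod a j%:Z b = 0) ->
  nprod a m (nprod b l c) = (-1) ^+ (p && q) *: nprod b l (nprod a m c)
    + \sum_(j < K) binz F m j *: nprod (nprod a j%:Z b) (m + l - j%:Z) c.
Proof.
move=> pa qb tr; have [N0 H] := super_commutator c m l pa qb.
rewrite -(@sum_ord_trunc (fun j => binz F m j *: nprod (nprod a j%:Z b) (m + l - j%:Z) c)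
  K (maxn N0 K)) ?leq_maxr //; last first.
  by move=> j /tr ->; rewrite nprod0l scaler0.
by rewrite -H ?leq_maxl // addrC subrK.
Qed.

(** For even [a] the sign is the same for both parities of [b], so [b] need not be homogeneous. *)
Lemma even_commutator a b c m l : homog false a ->
  exists N0 : nat, forall N, (N0 <= N)%N ->
    nprod a m (nprod b l c) - nprod b l (nprod a m c)
    = \sum_(j < N) binz F m j *: nprod (nprod a j%:Z b) (m + l - j%:Z) c.
Proof.
move=> ea; have [b0 [b1 [h0 h1 ->]]] := vs_homog_split b.
have [N0 H0] := super_commutator c m l ea h0.
have [N1 H1] := super_commutator c m l ea h1.
exists (maxn N0 N1) => N; rewrite geq_max => /andP[/H0 {}H0 /H1 {}H1].
under eq_bigr do rewrite nprodDr nprodDl scalerDr.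
rewrite big_split /= -H0 -H1 !andFb expr0 !scale1r !nprodDl !nprodDr.
by rewrite opprD addrACA.
Qed.

Lemma even_commutator_trunc K a b c m l : homog false a ->
  (forall j : nat, (K <= j)%N -> nprod a j%:Z b = 0) ->
  nprod a m (nprod b l c) = nprod b l (nprod a m c)
    + \sum_(j < K) binz F m j *: nprod (nprod a j%:Z b) (m + l - j%:Z) c.
Proof.
move=> ea tr; have [N0 H] := even_commutator b c m l ea.
rewrite -(@sum_ord_trunc (fun j => binz F m j *: nprod (nprod a j%:Z b) (m + l - j%:Z) c)
  K (maxn N0 K)) ?leq_maxr //; last first.
  by move=> j /tr ->; rewrite nprod0l scaler0.
by rewrite -H ?leq_maxl // addrC subrK.
Qed.

Lemma even_mode0_derivation a b c n : homog false a ->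
  nprod a 0 (nprod b n c) = nprod (nprod a 0 b) n c + nprod b n (nprod a 0 c).
Proof.
move=> ea; have [N0 H] := even_commutator b c 0 n ea.
have {H} := H N0.+1 (leqnSn _).
rewrite sum_ord_1 => [|j]; last by rewrite binz0S scale0r.
by rewrite /= binz0 scale1r subr0 add0r => <-; rewrite subrK.
Qed.

Lemma iterate_formula p q a b c n l : homog p a -> homog q b ->
  exists N0 : nat, forall N, (N0 <= N)%N ->
    nprod (nprod a n b) l c = \sum_(j < N) ((-1) ^+ j * binz F n j) *:
          (nprod a (n - j%:Z) (nprod b (l + j%:Z) c)
           - ((-1) ^ n * (-1) ^+ (p && q)) *:
               nprod b (n + l - j%:Z) (nprod a j%:Z c)).
Proof.
move=> pa qb; have [N0 H] := @vs_borcherds F V p q a b c 0 n l pa qb.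
exists N0.+1 => -[//|N] N0N; have {H} := H N.+1 (leqW N0N).
rewrite sum_ord_1 => [|j]; last by rewrite binz0S scale0r.
rewrite /= binz0 scale1r addr0 add0r subr0 => ->.
by apply: eq_bigr => j _; rewrite !add0r.
Qed.

Lemma normal_product_formula p q a b c l : homog p a -> homog q b ->
  exists N0 : nat, forall N, (N0 <= N)%N ->
    nprod (nprod a (-1) b) l c = \sum_(j < N)
          (nprod a (-1 - j%:Z) (nprod b (l + j%:Z) c)
           + (-1) ^+ (p && q) *: nprod b (l - 1 - j%:Z) (nprod a j%:Z c)).
Proof.
move=> pa qb; have [N0 H] := @iterate_formula p q a b c (-1) l pa qb.
exists N0 => N /H ->; apply: eq_bigr => j _.
rewrite binzN1 scale1r exprN1 invrN1 mulN1r scaleNr opprK.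
by rewrite [-1 + l]addrC.
Qed.

(** The Borcherds identity for [c = vac], [m = -1], [l = 0]. Nonnegative modes kill [vac], so on the
    right only [b_(n) a_(-1) vac] survives. *)
Lemma skew_symmetry p q a b n : homog p a -> homog q b ->
  exists N0 : nat, forall N, (N0 <= N)%N ->
    ((-1) ^ n * (-1) ^+ (p && q)) *: nprod b n a
    = - \sum_(j < N) (-1) ^+ j *: nprod (nprod a (n + j%:Z) b) (-1 - j%:Z) vac.
Proof.
move=> pa qb; have [N0 H] := @vs_borcherds F V p q a b vac (-1) n 0 pa qb.
exists N0.+1 => -[//|N] N0N; have {H} := H N.+1 (leqW N0N).
under eq_bigr do rewrite addr0.
have signE j : binz F (-1) j = (-1) ^+ j :> F.
  by rewrite -[LHS]mul1r -{1}(sqrr_sign F j) expr2 -mulrA binzN1 mulr1.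
under eq_bigr do rewrite signE.
move=> ->; rewrite sum_ord_1 => [|j]; last first.
  rewrite add0r (vs_vacr0 b j.+1) nprod0r sub0r.
  have -> : -1 + j.+1%:Z = j%:Z by lia.
  by rewrite vs_vacr0 nprod0r scaler0 oppr0 scaler0.
rewrite /= binz0 mulr1 scale1r !(addr0, subr0) (vs_vacr0 b 0) nprod0r sub0r opprK.
by rewrite vs_vacr.
Qed.

Lemma skew_symmetry_trunc K p q a b n : homog p a -> homog q b ->
  (forall j : nat, (K <= j)%N -> nprod a (n + j%:Z) b = 0) ->
  ((-1) ^ n * (-1) ^+ (p && q)) *: nprod b n a
  = - \sum_(j < K) (-1) ^+ j *: nprod (nprod a (n + j%:Z) b) (-1 - j%:Z) vac.
Proof.
move=> pa qb tr; have [N0 H] := skew_symmetry n pa qb.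
rewrite (H (maxn N0 K)) ?leq_maxl //; congr (- _).
apply: (@sum_ord_trunc (fun j => (-1) ^+ j *: nprod (nprod a (n + j%:Z) b) (-1 - j%:Z) vac)).
  exact: leq_maxr.
by move=> j /tr ->; rewrite nprod0l scaler0.
Qed.

Lemma homog_split_ind (P : V -> Prop) : (forall u v, P u -> P v -> P (u + v)) ->
  (forall p v, homog p v -> P v) -> forall v, P v.
Proof.
by move=> PD Ph v; have [v0 [v1 [/Ph h0 /Ph h1 ->]]] := vs_homog_split v; apply: PD.
Qed.

Definition transl v : V := nprod v (-2) vac.

Lemma translD u v : transl (u + v) = transl u + transl v.
Proof. exact: nprodDl. Qed.
Lemma translZ (k : F) v : transl (k *: v) = k *: transl v.
Proof. exact: nprodZl. Qed.

Lemma transl0 : transl 0 = 0. Proof. exact: nprod0l. Qed.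

Lemma transl_vac : transl vac = 0.
Proof. by rewrite /transl vs_vacl. Qed.

Lemma transl_homog p v : homog p v -> homog p (transl v).
Proof.
by move=> pv; have := vs_homog_nprod (-2) pv (vs_homog_vac V); rewrite addbF.
Qed.

(** In the iterate formula for [a_(-2) vac] the modes of [vac] are zero except the one of index -1,
    which selects the single index [j = |n| - 1] (none if [n = 0]). The coefficient there is
    [j + 1 = |n|], with the sign given by which of the two products contributes. *)
Lemma transl_mode a n c : nprod (transl a) n c = - n%:~R *: nprod a (n - 1) c.
Proof.
elim/homog_split_ind: a => [u v Hu Hv|p a pa].
  by rewrite translD !nprodDl Hu Hv scalerDr.
have [N0 H] := iterate_formula c (-2) n pa (vs_homog_vac V).
set N := (maxn N0 `|n|%N).+1; rewrite (H N); last by rewrite /N leqW // leq_maxl.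
have sgn : (-1) ^ (-2) * (-1) ^+ (p && false) = 1 :> F.
  by rewrite andbF mulr1 -invr_expz -exprnP sqrrN expr1n invr1.
under eq_bigr => j _.
  rewrite binzN2 sgn scale1r !vs_vacl.
  rewrite (_ : (n + j%:Z == -1) = (n == - j.+1%:Z)); last by lia.
  rewrite (_ : (-2 + n - j%:Z == -1) = (n == j.+1%:Z)); last by lia.
  over.
rewrite /=.
have {H} : (`|n| < N)%N by rewrite /N; lia.
clearbody N; case: n => [[|n]|n] nN.
- rewrite big1 ?oppr0 ?scale0r // => j _.
  have -> : (Posz 0 == - j.+1%:Z) = false by lia.
  by rewrite nprod0r subr0 scaler0.
- have {}nN : (n < N)%N by lia.
  have e j : (n.+1%:Z == - j.+1%:Z) = false by lia.
  rewrite (bigD1 (Ordinal nN)) // big1 => [|j].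
    rewrite [LHS]addr0 eqxx e nprod0r sub0r scalerN scaleNr.
    by congr (- (_ *: nprod _ _ _)); rewrite /=; lia.
  rewrite -val_eqE => jn; rewrite e nprod0r.
  have -> : (n.+1 == j.+1 :> int) = false by move: jn => /=; lia.
  by rewrite subr0 scaler0.
- have {}nN : (n < N)%N by lia.
  have e j : (Negz n == j.+1%:Z) = false by [].
  rewrite (bigD1 (Ordinal nN)) // big1 => [|j].
    rewrite [LHS]addr0 e -NegzE eqxx subr0 NegzE mulrNz opprK.
    by congr (_ *: nprod _ _ _); rewrite /=; lia.
  rewrite -val_eqE => jn; rewrite e.
  have -> : (Negz n == - j.+1%:Z) = false by move: jn => /=; lia.
  by rewrite nprod0r subr0 scaler0.
Qed.

(** The iterate formula applied to [(a_(n) b)_(-2) vac]: since [b_(-2 + j) vac = 0] for [j >= 2],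
    the terms [j = 0] and [j = 1] are the two sides of the Leibniz rule. *)
Lemma transl_derivation a n b :
  transl (nprod a n b) = nprod (transl a) n b + nprod a n (transl b).
Proof.
elim/homog_split_ind: a => [u v Hu Hv|p a pa].
  by rewrite translD !nprodDl translD Hu Hv addrACA.
elim/homog_split_ind: b => [u v Hu Hv|q b qb].
  by rewrite !(nprodDr, translD) Hu Hv addrACA.
rewrite [LHS]/transl; have [N0 H] := iterate_formula vac n (-2) pa qb.
rewrite (H N0.+2); last by rewrite !leqW.
have a0 (j : nat) : nprod a j vac = 0 by exact: vs_vacr0.
under eq_bigr do rewrite a0 nprod0r scaler0 subr0.
rewrite 2!big_ord_recl big1 => [|j _]; last first.
  rewrite /= (_ : -2 + _ = j%:Z); last by rewrite /bump; lia.
  by rewrite vs_vacr0 nprod0r scaler0.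
rewrite /= binz0 mulr1 scale1r binz1 !addr0 expr1 mulN1r.
by rewrite transl_mode addrC (_ : -2 + (bump 0 0)%:Z = -1) // vs_vacr.
Qed.

(** This and [skew_mode1] serve to read the action of a composite vector [b] on a current [a] off
    the modes of [a] on [b], which can be computed. *)
Lemma skew_mode0 p a b : homog p a -> homog false b ->
  (forall j : nat, (1 < j)%N -> nprod a j%:Z b = 0) ->
  nprod b 0 a = transl (nprod a 1 b) - nprod a 0 b.
Proof.
move=> pa eb tr; have := @skew_symmetry_trunc 2 _ _ _ _ 0 pa eb.
rewrite andbF expr0z mulr1 scale1r => ->; last by move=> j /tr; rewrite add0r.
rewrite !big_ord_recl big_ord0 /= expr0 expr1 scale1r scaleN1r !(addr0, subr0) vs_vacr.
by rewrite opprB addrC.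
Qed.

Lemma skew_mode1 p a b : homog p a -> homog false b ->
  (forall j : nat, (1 < j)%N -> nprod a j%:Z b = 0) ->
  nprod b 1 a = nprod a 1 b.
Proof.
move=> pa eb tr; have := @skew_symmetry_trunc 1 _ _ _ _ 1 pa eb.
rewrite andbF mulr1 expr1z scaleN1r => H; apply: oppr_inj; rewrite H.
  by rewrite big_ord_recl big_ord0 /= expr0 scale1r !(addr0, subr0) vs_vacr.
by move=> [|j] // _; rewrite (_ : 1 + _ = j.+2%:Z) ?tr //; lia.
Qed.

(* v_(-1-j) 1 = D^j v / j! *)
Lemma mode_vacS v (j : nat) :
  j.+1%:R *: nprod v (-1 - j.+1%:Z) vac = transl (nprod v (-1 - j%:Z) vac).
Proof.
rewrite transl_derivation transl_vac nprod0r addr0 transl_mode.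
rewrite -mulrNz (_ : - (-1 - j%:Z) = j.+1%:Z); last by lia.
by congr (_ *: nprod _ _ _); lia.
Qed.

Lemma transl_closed_mode_vac S : subspace S ->
  (forall v, S v -> S (transl v)) ->
  forall v (j : nat), S v -> S (nprod v (-1 - j%:Z) vac).
Proof.
move=> hS SD v j Sv; elim: j => [|j IH]; first by rewrite subr0 vs_vacr.
have := SD _ IH; rewrite -mode_vacS => /(subspZ hS j.+1%:R^-1).
by rewrite scalerA mulVf ?pnatr_eq0 // scale1r.
Qed.

End Modes.

(** * Generated subalgebras, eigenvectors and finite sums *)

Section Generation.
Variables (F : numFieldType) (V : vertexSuperalgebra F).
Implicit Types (a b c u v w : V) (n m l : int) (p q : bool) (S M G : set V).

Lemma generated_subalgebra G : vertex_subalgebra (generated_by G).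
Proof.
split; first split.
- by move=> S [[[S0 _] _ _] _].
- move=> k u v Gu Gv S HS; case: (HS) => -[[_ Slin] _ _] _.
  by apply: Slin; [apply: Gu|apply: Gv].
- by move=> S [[_ Sv _] _].
- move=> u n v Gu Gv S HS; case: (HS) => -[_ _ Sn] _.
  by apply: Sn; [apply: Gu|apply: Gv].
Qed.

Lemma subspace_generated G : subspace (generated_by G).
Proof. by case: (generated_subalgebra G). Qed.

Lemma generated_vac G : generated_by G vac.
Proof. by case: (generated_subalgebra G). Qed.

Lemma generated_nprod G u n v :
  generated_by G u -> generated_by G v -> generated_by G (nprod u n v).
Proof. by case: (generated_subalgebra G) => _ _ H; apply: H. Qed.

Lemma generated_by_sub G S : vertex_subalgebra S -> G `<=` S -> generated_by G `<=` S.
Proof. exact: smallest_sub. Qed.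

Lemma sub_generated G : G `<=` generated_by G.
Proof. exact: sub_gen_smallest. Qed.

Definition preserves M u := forall n c, M c -> M (nprod u n c).

Lemma preserves_iterate M p q a b n : subspace M -> homog p a -> homog q b ->
  preserves M a -> preserves M b -> preserves M (nprod a n b).
Proof.
move=> hM pa qb Ma Mb l c Mc; have [N H] := iterate_formula c n l pa qb.
rewrite (H N) //; apply: (subsp_sum hM) => j _; apply: (subspZ hM).
by apply: (subspB hM); [|apply: (subspZ hM)]; [apply/Ma/Mb|apply/Mb/Ma].
Qed.

Lemma subspace_preserves M : subspace M -> subspace (preserves M).
Proof.
move=> hM; split=> [n c _|k u v Mu Mv n c Mc]; first by rewrite nprod0l; apply: subsp0.
rewrite nprodDl nprodZl; apply: (subspD hM); last exact: Mv.
by apply: (subspZ hM); apply: Mu.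
Qed.

(** The iterate formula needs homogeneous factors. The induction therefore runs over [K], where both
    parity components preserve [M] separately. *)
Lemma generated_preserves G M : subspace M ->
  (forall g, G g -> exists p, homog p g) -> (forall g, G g -> preserves M g) ->
  forall u, generated_by G u -> preserves M u.
Proof.
move=> hM hG GM u.
have hP := subspace_preserves hM.
pose K := [set u : V | exists u0 u1, [/\ homog false u0, homog true u1,
  preserves M u0, preserves M u1 & u = u0 + u1]].
suff KE : generated_by G `<=` K.
  by move=> /KE[u0 [u1 [_ _ M0 M1 ->]]]; apply: (subspD hP).
have hh := subspace_homog V.
apply: generated_by_sub => [|g Gg]; last first.
  have [[] pg] := hG g Gg.
    exists 0, g; rewrite add0r; split=> //; [exact: vs_homog0|exact: (subsp0 hP)|exact: GM].
  exists g, 0; rewrite addr0; split=> //; [exact: vs_homog0|exact: GM|exact: (subsp0 hP)].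
split; first split.
- by exists 0, 0; rewrite addr0; split=> //; [exact: vs_homog0..|exact: subsp0|exact: subsp0].
- move=> k x y [x0 [x1 [hx0 hx1 Mx0 Mx1 ->]]] [y0 [y1 [hy0 hy1 My0 My1 ->]]].
  exists (k *: x0 + y0), (k *: x1 + y1); split; try exact: vs_homog_lin.
  + by case: hP => _; apply.
  + by case: hP => _; apply.
  + by rewrite scalerDr addrACA.
- exists vac, 0; rewrite addr0; split=> //;
    [exact: vs_homog_vac|exact: vs_homog0| |exact: (subsp0 hP)].
  by move=> n c Mc; rewrite vs_vacl; case: eqP => // _; apply: (subsp0 hM).
- move=> x n y [x0 [x1 [hx0 hx1 Mx0 Mx1 ->]]] [y0 [y1 [hy0 hy1 My0 My1 ->]]].
  exists (nprod x0 n y0 + nprod x1 n y1), (nprod x0 n y1 + nprod x1 n y0).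
  have H p q := @vs_homog_nprod F V p q.
  split.
  + by apply: (subspD (hh _)); [exact: (H false false)|exact: (H true true)].
  + by apply: (subspD (hh _)); [exact: (H false true)|exact: (H true false)].
  + by apply: (subspD hP); [exact: (@preserves_iterate _ false false)|
      exact: (@preserves_iterate _ true true)].
  + by apply: (subspD hP); [exact: (@preserves_iterate _ false true)|
      exact: (@preserves_iterate _ true false)].
  + by rewrite nprodDl !nprodDr [nprod x1 n y0 + _]addrC addrACA.
Qed.

(** Every [u] is [u_(-1) vac], so a subspace that contains [vac] and is stable under the modes of
    the generators contains all that they generate, without being closed under products itself. *)
Lemma generated_module G M : subspace M -> M vac ->
  (forall g, G g -> exists p, homog p g) -> (forall g, G g -> preserves M g) ->
  generated_by G `<=` M.
Proof.
move=> hM Mvac hG GM u Gu; rewrite -[u]vs_vacr.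
exact: (generated_preserves hM hG GM).
Qed.

Lemma generated_even G : (forall g, G g -> homog false g) ->
  forall u, generated_by G u -> homog false u.
Proof.
move=> Ge; apply: generated_by_sub => //; split; first exact: subspace_homog.
  exact: vs_homog_vac.
by move=> u n v; apply: vs_homog_nprod.
Qed.

(** The corrections in skew-symmetry involve only products [a_(m) b] with [m > n], so modulo [S]
    only the sign remains. *)
Lemma skew_symmetry_mod p q a b n S : vertex_subalgebra S ->
  homog p a -> homog q b -> (forall m, n < m -> S (nprod a m b)) ->
  S (nprod a n b + ((-1) ^ n * (-1) ^+ (p && q)) *: nprod b n a).
Proof.
move=> [hS Svac Sn] pa qb Sm; have [N H] := skew_symmetry n pa qb.
rewrite (H N.+1) // big_ord_recl /= expr0 scale1r addr0 vs_vacr opprD addrA subrr add0r.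
apply: (subspN hS); apply: (subsp_sum hS) => j _; apply: (subspZ hS); apply: Sn => //.
by apply: Sm; rewrite /bump; lia.
Qed.

(* By descending induction on n, from the Borcherds identity for an m so large that
   all a_(m + j) c vanish. *)
Lemma associativity_span p q a b c M : subspace M -> homog p a -> homog q b ->
  (forall i j, M (nprod (nprod a i b) j c)) ->
  forall m n, M (nprod a m (nprod b n c)).
Proof.
move=> hM pa qb Mij m n; have [B HB] := vs_truncation b c.
have [A HA] := vs_truncation a c.
suff H (k : nat) : forall n m, B - k%:Z <= n -> M (nprod a m (nprod b n c)).
  by apply: (H `|B - n|%N); lia.
elim: k => {m n} [|k IH] n m Hn.
  by rewrite (HB n) ?nprod0r; [exact: subsp0|lia].
have [N H] := @vs_borcherds F V p q a b c A (m - A) n pa qb.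
have {H} := H N.+1 (leqnSn _).
rewrite [X in _ = X]big_ord_recl /= binz0 mulr1 scale1r !(addr0, subr0).
rewrite (HA A) // nprod0r scaler0 subr0 (_ : A + (m - A) = m); last by lia.
move=> /esym/(canRL (addrK _)) ->; apply: (subspB hM); apply: (subsp_sum hM) => j _;
  apply: (subspZ hM) => //.
rewrite (HA (A + _)) ?nprod0r ?scaler0 ?subr0; first by apply: IH; rewrite /bump; lia.
by rewrite lerDl.
Qed.

Definition linear_op (T : V -> V) := forall (k : F) u v, T (k *: u + v) = k *: T u + T v.

Section LinearOperators.
Variables (T : V -> V) (hT : linear_op T).

Lemma linop0 : T 0 = 0.
Proof.
have := hT 1 0 0; rewrite !scale1r !addr0 -[X in X = _]addr0.
by move/addrI.
Qed.

Lemma linopD u v : T (u + v) = T u + T v.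
Proof. by have := hT 1 u v; rewrite !scale1r. Qed.

Lemma linopZ (k : F) v : T (k *: v) = k *: T v.
Proof. by have := hT k v 0; rewrite linop0 !addr0. Qed.

Lemma linopN v : T (- v) = - T v.
Proof. by rewrite -scaleN1r linopZ scaleN1r. Qed.

Lemma linopB u v : T (u - v) = T u - T v.
Proof. by rewrite linopD linopN. Qed.

Lemma linop_sum (I : Type) (r : seq I) (P : pred I) (f : I -> V) :
  T (\sum_(i <- r | P i) f i) = \sum_(i <- r | P i) T (f i).
Proof. by apply: (big_morph T); [exact: linopD|exact: linop0]. Qed.

Definition eigenvector (mu : F) v := T v = mu *: v.

Lemma subspace_eigenvector mu : subspace (eigenvector mu).
Proof.
split=> [|k u v Hu Hv]; rewrite /eigenvector; first by rewrite linop0 scaler0.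
by rewrite hT Hu Hv scalerDr !scalerA mulrC.
Qed.

(** Applying [T - nu] for the eigenvalue [nu] of the first summand removes that summand and
    multiplies [w] by the nonzero number [mu - nu]. The eigenvalues of the summands may repeat. *)
Lemma eigenvector_sum_eq0 mu (s : seq V) w : eigenvector mu w ->
  w = \sum_(u <- s) u ->
  (forall u, u \in s -> exists2 nu, nu != mu & eigenvector nu u) -> w = 0.
Proof.
have [n] := ubnP (size s); elim: n s w => // n IH [|u s] w /=.
  by rewrite big_nil.
rewrite ltnS => sn Tw ws Hs.
have [nu nu_mu Tu] := Hs u (mem_head _ _).
suff : (mu - nu) *: w = 0.
  by move/eqP; rewrite scaler_eq0 subr_eq0 eq_sym (negPf nu_mu) => /eqP.
apply: (IH [seq T v - nu *: v | v <- s]); first by rewrite size_map.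
- by apply: (subspZ (subspace_eigenvector mu)).
- rewrite scalerBl -Tw ws !(big_cons, linopD, linop_sum, scalerDr) Tu opprD.
  by rewrite addrACA subrr add0r scaler_sumr big_map sumrB.
- move=> _ /mapP[v vs ->]; have [k kmu Tv] := Hs v (@mem_behead _ (u :: s) _ vs).
  exists k => //; apply: (subspB (subspace_eigenvector k)).
    by rewrite Tv; apply: (subspZ (subspace_eigenvector k)).
  by apply: (subspZ (subspace_eigenvector k)).
Qed.

End LinearOperators.

Lemma nilpotent_independent (T : V -> V) u : linear_op T ->
  T (T u) != 0 -> T (T (T u)) = 0 ->
  forall c0 c1 c2 : F, c0 *: u + (c1 *: T u + c2 *: T (T u)) = 0 ->
  [/\ c0 = 0, c1 = 0 & c2 = 0].
Proof.
move=> hT T2 T3 c0 c1 c2 H.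
have c00 : c0 = 0.
  have := congr1 T (congr1 T H); rewrite !(linopD hT, linopZ hT) T3 !(linop0 hT).
  by rewrite !scaler0 !addr0 => /eqP; rewrite scaler_eq0 (negPf T2) orbF => /eqP.
have c10 : c1 = 0.
  have := congr1 T H; rewrite c00 scale0r add0r !(linopD hT, linopZ hT) T3 (linop0 hT).
  by rewrite scaler0 addr0 => /eqP; rewrite scaler_eq0 (negPf T2) orbF => /eqP.
split=> //; move/eqP: H; rewrite c00 c10 !scale0r !add0r.
by rewrite scaler_eq0 (negPf T2) orbF => /eqP.
Qed.

Lemma linear_op_mode a n : linear_op (nprod a n).
Proof. by move=> k u v; rewrite nprodDr nprodZr. Qed.

Lemma linear_op_transl : linear_op (@transl F V).
Proof. by move=> k u v; rewrite translD translZ. Qed.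

Lemma linear_op_sub (T U : V -> V) :
  linear_op T -> linear_op U -> linear_op (fun v => T v - U v).
Proof. by move=> hT hU k u v; rewrite hT hU opprD addrACA scalerBr. Qed.

Definition sums (P : set V) : set V :=
  [set v | exists2 s : seq V, v = \sum_(u <- s) u & forall u, u \in s -> P u].

Section Sums.
Implicit Types P Q : set V.

Lemma sums0 P : sums P 0.
Proof. by exists [::]; rewrite ?big_nil. Qed.

Lemma sums1 P v : P v -> sums P v.
Proof.
move=> Pv; exists [:: v]; first by rewrite big_seq1.
by move=> u; rewrite inE => /eqP ->.
Qed.

Lemma sumsD P u v : sums P u -> sums P v -> sums P (u + v).
Proof.
move=> [s -> Ps] [t -> Pt]; exists (s ++ t); first by rewrite big_cat.
by move=> x; rewrite mem_cat => /orP[/Ps|/Pt].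
Qed.

Lemma sums_linop P Q (T : V -> V) : linear_op T ->
  (forall u, P u -> sums Q (T u)) -> forall v, sums P v -> sums Q (T v).
Proof.
move=> hT PQ v [s -> Ps]; elim: s Ps => [|u s IH] Ps.
  by rewrite big_nil linop0 //; apply: sums0.
rewrite big_cons linopD //; apply: sumsD; first by apply/PQ/Ps/mem_head.
by apply: IH => x xs; apply: Ps; rewrite inE xs orbT.
Qed.

Lemma sumsS P Q : P `<=` Q -> sums P `<=` sums Q.
Proof. by move=> PQ v [s vs Ps]; exists s => // u /Ps/PQ. Qed.

Lemma subspace_sums P : (forall (k : F) v, P v -> P (k *: v)) -> subspace (sums P).
Proof.
move=> PZ; split=> [|k u v [s -> Ps] Pv]; first exact: sums0.
apply: sumsD => //; exists [seq k *: x | x <- s].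
  by rewrite big_map scaler_sumr.
by move=> _ /mapP[x /Ps/PZ Hx ->].
Qed.

Lemma sums_subspace P S : subspace S -> P `<=` S -> sums P `<=` S.
Proof. by move=> hS PS v [s -> Ps]; apply: subsp_sum_seq => // u /Ps/PS. Qed.

End Sums.

(** This replaces a projection: if [w] has a decomposition with [mu]-part [a], and [w] itself has
    eigenvalue [mu], the rest is zero. *)
Lemma eigenvector_component (T : V -> V) mu w a : linear_op T ->
  eigenvector T mu w -> eigenvector T mu a ->
  sums [set u | exists2 nu, nu != mu & eigenvector T nu u] (w - a) -> w = a.
Proof.
move=> hT Tw Ta [s ws Hs]; apply/eqP; rewrite -subr_eq0; apply/eqP.
apply: (eigenvector_sum_eq0 hT _ ws Hs).
exact: (subspB (subspace_eigenvector hT mu)).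
Qed.

End Generation.

(** * Affine vertex superalgebras *)

Section AffineModes.
Variables (F : numFieldType) (g : lieSuperData F) (k : F).
Variables (V : vertexSuperalgebra F) (J : g -> V).
Implicit Types (a b : g) (v : V).

(** The span of words in creation modes applied to the vectors of [B], with degree and parity
    recorded. The words are not ordered: only spanning and lower bounds for the degree are at stake.
    It is used with [vac] as base, and with a singular vector and its derivatives. *)
Inductive pbw (B : int -> bool -> set V) : int -> bool -> set V :=
| pbw_base d p v : B d p v -> pbw B d p v
| pbw_neg a (m : nat) d p v : pbw B d p v ->
    pbw B (d - Negz m) (lie_odd a (+) p) (nprod (J a) (Negz m) v)
| pbw_zero d p : pbw B d p 0
| pbw_lin d p (c : F) u v : pbw B d p u -> pbw B d p v -> pbw B d p (c *: u + v).

Lemma subspace_pbw B d p : subspace (pbw B d p).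
Proof. by split=> [|c u v]; [exact: pbw_zero|exact: pbw_lin]. Qed.

Lemma pbw_degree_ge B d0 : (forall d p v, B d p v -> d0 <= d) ->
  forall d p v, pbw B d p v -> d0 <= d \/ v = 0.
Proof.
move=> hB d p v; elim=> {d p v}
  [d p v Bv|a m d p v _ [dd|->]|d p|d p c u v _ [du|->] _ [dv|->]]; try by left.
- by left; apply: hB Bv.
- by left; lia.
- by right; rewrite nprod0r.
- by right.
- by right; rewrite scaler0 addr0.
Qed.

Lemma pbw_degree B : (forall d p v, B d p v -> degree J d v) ->
  forall d p v, pbw B d p v -> degree J d v.
Proof.
move=> hB d p v; elim=> {d p v} [d p v /hB//|a m d p v _|d p|d p c u v _ du _ dv].
- exact: degree_mode.
- exact: degree_zero.
- exact: degree_lin.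
Qed.

Hypothesis hJ : affine_at_level k J.

Lemma affine_homog a : homog (lie_odd a) (J a).
Proof. by case: hJ. Qed.

Lemma pbw_homog B : (forall d p v, B d p v -> homog p v) ->
  forall d p v, pbw B d p v -> homog p v.
Proof.
move=> hB d p v; elim=> {d p v} [d p v /hB//|a m d p v _|d p|d p c u v _ du _ dv].
- exact/vs_homog_nprod/affine_homog.
- exact: vs_homog0.
- exact: vs_homog_lin.
Qed.

Lemma affine_commutator a b m n v :
  nprod (J a) m (nprod (J b) n v) =
    (-1) ^+ (lie_odd a && lie_odd b) *: nprod (J b) n (nprod (J a) m v)
    + \sum_(t <- lie_br a b) t.1 *: nprod (J t.2) (m + n) v
    + (if m + n == 0 then m%:~R * (k * lie_form a b) else 0) *: v.
Proof.
case: hJ => hom rel.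
rewrite (@super_commutator_trunc F V 2 _ _ _ _ v m n (hom a) (hom b)); last first.
  by move=> [|[|j]] // _; rewrite rel.
rewrite !big_ord_recl big_ord0 /= binz0 binz1 scale1r !(subr0, addr0) addrA.
rewrite (rel _ _ 0%N) (rel _ _ 1%N).
congr (_ + _ + _).
  by rewrite nprod_suml; apply: eq_bigr => t _; rewrite nprodZl.
rewrite nprodZl vs_vacl scalerA (_ : (m + n - _ == -1) = (m + n == 0)); last first.
  by rewrite /bump /=; lia.
by case: ifP; rewrite ?scale0r ?scaler0.
Qed.

Hypothesis br_parity :
  forall a b, all (fun t => lie_odd t.2 == lie_odd a (+) lie_odd b) (lie_br a b).
Hypothesis form_parity : forall a b, lie_odd a != lie_odd b -> lie_form a b = 0.

Section Pbw.
Variable B : int -> bool -> set V.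
Hypothesis hB : forall d p v, B d p v -> forall a (n : nat), nprod (J a) n%:Z v = 0.

Let pbw_mode_of d p v :
  pbw B d p v ->
  (forall a (n : nat), pbw B (d - n%:Z) (lie_odd a (+) p) (nprod (J a) n%:Z v)) ->
  forall a n, pbw B (d - n) (lie_odd a (+) p) (nprod (J a) n v).
Proof. by move=> Pv Pn a [n|n]; [exact: Pn|exact: pbw_neg]. Qed.

(** An annihilation mode is commuted to the right until it reaches a vector of [B]. The bracket
    produces a mode of either sign, which is why the induction goes through [pbw_mode_of]. *)
Lemma pbw_mode d p v : pbw B d p v ->
  forall a n, pbw B (d - n) (lie_odd a (+) p) (nprod (J a) n v).
Proof.
move=> Pv; apply: (pbw_mode_of Pv).
elim: Pv => {d p v} [d p v Bv|b m d p v Pv IH|d p|d p c u v _ IHu _ IHv] a n.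
- by rewrite (hB Bv); apply: pbw_zero.
- have hS := subspace_pbw B (d - Negz m - n%:Z) (lie_odd a (+) (lie_odd b (+) p)).
  rewrite affine_commutator; apply: (subspD hS); first apply: (subspD hS).
  + apply: (subspZ hS); have := pbw_neg b m (IH a n).
    by rewrite addrAC addbCA.
  + have := br_parity a b; elim: (lie_br a b) => [|t s IHs] /=.
      by rewrite big_nil => _; apply: pbw_zero.
    move=> /andP[/eqP tp /IHs Ps]; rewrite big_cons.
    apply: (subspD hS) => //; apply: (subspZ hS).
    have := pbw_mode_of Pv IH t.2 (n%:Z + Negz m).
    by rewrite tp -addbA opprD addrA addrAC.
  + case: ifP => [/eqP nm|_]; last by rewrite scale0r; apply: pbw_zero.
    case: (eqVneq (lie_odd a) (lie_odd b)) => [ab|/form_parity ->]; last first.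
      by rewrite !mulr0 scale0r; apply: pbw_zero.
    apply: (subspZ hS); rewrite ab addbA addbb addFb.
    by rewrite (_ : d - Negz m - n%:Z = d) //; lia.
- by rewrite nprod0r; apply: pbw_zero.
- by rewrite nprodDr nprodZr; apply: pbw_lin.
Qed.

Definition pbw_span : set V := sums [set v | exists d p, pbw B d p v].

Lemma subspace_pbw_span : subspace pbw_span.
Proof.
apply: subspace_sums => c v [d [p Pv]]; exists d, p.
exact: (subspZ (subspace_pbw B d p)).
Qed.

Lemma pbw_span_preserved a : preserves pbw_span (J a).
Proof.
move=> n v; apply: (sums_linop (linear_op_mode (J a) n)) => u [d [p Pu]].
by apply: sums1; exists (d - n), (lie_odd a (+) p); apply: pbw_mode.
Qed.

Lemma generated_pbw_preserved u :
  generated_by (range J) u -> preserves pbw_span u.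
Proof.
apply: generated_preserves; first exact: subspace_pbw_span.
- by move=> _ [a _ <-]; exists (lie_odd a); apply: affine_homog.
- by move=> _ [a _ <-]; apply: pbw_span_preserved.
Qed.

End Pbw.

End AffineModes.

(** * Normal ordering by computation *)

Section NormalOrdering.

(** Numbering the basis gives letters a decidable equality and the order e < f < h < x < y, which
    breaks ties between equal modes in the normal form. *)
Fixpoint dec_basis (n : nat) : osp12_basis :=
  match n with
  | 0 => osp12_even sl2_e | 1 => osp12_even sl2_f | 2 => osp12_even sl2_h
  | 3 => osp12_x | _ => osp12_y
  end%N.

Definition enc_basis (a : osp12_basis) : nat :=
  match a with
  | osp12_even sl2_e => 0 | osp12_even sl2_f => 1 | osp12_even sl2_h => 2
  | osp12_x => 3 | osp12_y => 4
  end%N.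

Lemma enc_basisK a : dec_basis (enc_basis a) = a.
Proof. by case: a => [[]| |]. Qed.

Let word := seq (nat * int).
Let poly := seq (rat * word).

Definition scale_poly (c : rat) (p : poly) : poly := [seq (c * t.1, t.2) | t <- p].

Definition level : rat := - (3 / 2).

(* When the fuel runs out a word is left unordered, which is still sound. *)
Fixpoint act (fuel : nat) (l : nat * int) (w : word) {struct fuel} : poly :=
  match fuel, w with
  | 0%N, _ => [:: (1, l :: w)]
  | fuel'.+1, [::] => if (0 <= l.2) then [::] else [:: (1, [:: l])]
  | fuel'.+1, l2 :: w' =>
      let a := dec_basis l.1 in let b := dec_basis l2.1 in
      let brackets :=
        flatten [seq scale_poly t.1 (act fuel' (enc_basis t.2, l.2 + l2.2) w')
                | t <- osp12_br rat a b]
        ++ (if l.2 + l2.2 == 0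
            then [:: (l.2%:~R * (level * osp12_form rat a b), w')] else [::]) in
      if (l == l2) && osp12_odd a then scale_poly (1 / 2) brackets
      else if (l.2 < 0) && ((l.2 < l2.2) || (l.2 == l2.2) && (l.1 <= l2.1)%N)
      then [:: (1, l :: w)]
      else scale_poly ((-1) ^+ (osp12_odd a && osp12_odd b))
             (flatten [seq scale_poly t.1 (act fuel' l2 t.2) | t <- act fuel' l w'])
           ++ brackets
  end.

Inductive expr :=
| EVac
| EMode of osp12_basis & int & expr
| EAdd of expr & expr
| EScale of rat & expr.

Fixpoint normalize (fuel : nat) (e : expr) : poly :=
  match e with
  | EVac => [:: (1, [::])]
  | EMode a n e => flatten [seq scale_poly t.1 (act fuel (enc_basis a, n) t.2)
                           | t <- normalize fuel e]
  | EAdd e1 e2 => normalize fuel e1 ++ normalize fuel e2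
  | EScale c e => scale_poly c (normalize fuel e)
  end.

Fixpoint poly_eq0 (n : nat) (p : poly) : bool :=
  match n, p with
  | _, [::] => true
  | 0%N, _ => false
  | n'.+1, t :: _ =>
      (foldr (fun u c => u.1 + c) 0 [seq u <- p | u.2 == t.2] == 0)
      && poly_eq0 n' [seq u <- p | u.2 != t.2]
  end.

(** A sufficient test for equality at level -3/2. The fuel 30 bounds the reordering; too little fuel
    could only make the test fail. *)
Definition expr_eq (e1 e2 : expr) : bool :=
  let p := normalize 30 (EAdd e1 (EScale (-1) e2)) in poly_eq0 (size p) p.

Variables (F : numFieldType) (V : vertexSuperalgebra F) (J : osp12 F -> V).

Fixpoint eval (e : expr) : V :=
  match e with
  | EVac => vac
  | EMode a n e => nprod (J a) n (eval e)
  | EAdd e1 e2 => eval e1 + eval e2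
  | EScale c e => ratr c *: eval e
  end.

Let eval_word (w : word) : V := foldr (fun l v => nprod (J (dec_basis l.1)) l.2 v) vac w.
Let eval_poly (p : poly) : V := \sum_(t <- p) ratr t.1 *: eval_word t.2.

Let eval_scale c p : eval_poly (scale_poly c p) = ratr c *: eval_poly p.
Proof.
rewrite /eval_poly big_map scaler_sumr.
by apply: eq_bigr => t _; rewrite rmorphM scalerA.
Qed.

Let eval_cat p1 p2 : eval_poly (p1 ++ p2) = eval_poly p1 + eval_poly p2.
Proof. exact: big_cat. Qed.

Let eval_flatten (T : Type) (f : T -> poly) s :
  eval_poly (flatten [seq f t | t <- s]) = \sum_(t <- s) eval_poly (f t).
Proof.
elim: s => [|t s IH] /=; first by rewrite /eval_poly !big_nil.
by rewrite eval_cat IH big_cons.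
Qed.

(** The structure constants are rational, so a computation over [rat], where equality is decided by
    evaluation, transfers to every [F]. *)
Lemma osp12_br_ratr a b :
  osp12_br F a b = [seq (ratr t.1, t.2) | t <- osp12_br rat a b].
Proof.
by case: a b => [[]| |] [[]| |] //=; rewrite ?(rmorphN, rmorph1, rmorph_nat).
Qed.

Lemma osp12_form_ratr a b : osp12_form F a b = ratr (osp12_form rat a b).
Proof.
by case: a b => [[]| |] [[]| |] //=; rewrite ?(rmorphN, rmorph1, rmorph_nat, rmorph0).
Qed.

Lemma osp12_br_parity (a b : osp12 F) :
  all (fun t => lie_odd t.2 == lie_odd a (+) lie_odd b) (lie_br a b).
Proof. by case: a b => [[]| |] [[]| |]. Qed.

Lemma osp12_form_parity (a b : osp12 F) : lie_odd a != lie_odd b -> lie_form a b = 0.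
Proof. by case: a b => [[]| |] [[]| |]. Qed.

Hypothesis hJ : affine_at_level (- (3 / 2)) J.

Let affine_commutator_ratr a b m n v :
  nprod (J a) m (nprod (J b) n v) =
    (-1) ^+ (osp12_odd a && osp12_odd b) *: nprod (J b) n (nprod (J a) m v)
    + (\sum_(t <- osp12_br rat a b) ratr t.1 *: nprod (J t.2) (m + n) v
    + ratr (if m + n == 0 then m%:~R * (level * osp12_form rat a b) else 0) *: v).
Proof.
rewrite (affine_commutator hJ) /= osp12_br_ratr big_map -addrA.
congr (_ + (_ + _ *: _)); case: ifP => _; last by rewrite rmorph0.
rewrite osp12_form_ratr !rmorphM /= ratr_int; congr (_ * (_ * _)).
by rewrite /level rmorphN fmorph_div !rmorph_nat.
Qed.

Let eval_act fuel l w :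
  eval_poly (act fuel l w) = nprod (J (dec_basis l.1)) l.2 (eval_word w).
Proof.
elim: fuel l w => [|fuel IH] l w.
  by rewrite /= /eval_poly big_seq1 rmorph1 scale1r.
case: w => [|l2 w] /=.
  case: l => a [n|n] /=; first by rewrite vs_vacr0 /eval_poly big_nil.
  by rewrite /eval_poly big_seq1 rmorph1 scale1r.
set a := dec_basis l.1; set b := dec_basis l2.1.
set br := flatten _ ++ _.
have brE : eval_poly br =
  \sum_(t <- osp12_br rat a b) ratr t.1 *: nprod (J t.2) (l.2 + l2.2) (eval_word w)
    + ratr (if l.2 + l2.2 == 0 then l.2%:~R * (level * osp12_form rat a b) else 0)
      *: eval_word w.
  rewrite /br eval_cat eval_flatten; congr (_ + _).
    by apply: eq_bigr => t _; rewrite eval_scale IH /= enc_basisK.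
  case: ifP => _; first by rewrite /eval_poly big_seq1.
  by rewrite /eval_poly big_nil rmorph0 scale0r.
(* Two equal odd letters do not commute past each other: the relation reads X = - X + B, hence X =
   B/2, which is the factor 1/2 in [act]. *)
case: ifP => [/andP[/eqP ll oa]|_].
  rewrite eval_scale brE /b -!ll -/a.
  set B := (X in ratr _ *: X).
  have E : nprod (J a) l.2 (nprod (J a) l.2 (eval_word w)) =
           - nprod (J a) l.2 (nprod (J a) l.2 (eval_word w)) + B.
    by rewrite {1}affine_commutator_ratr oa expr1 scaleN1r.
  move/eqP: E; rewrite addrC -subr_eq opprK => /eqP <-.
  rewrite fmorph_div rmorph1 rmorph_nat -mulr2n -scaler_nat scalerA.
  by rewrite mul1r mulVf ?scale1r // pnatr_eq0.
case: ifP => _; first by rewrite /eval_poly big_seq1 rmorph1 scale1r.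
rewrite eval_cat brE affine_commutator_ratr -/a -/b; congr (_ + _).
rewrite eval_scale rmorphXn rmorphN1; congr (_ *: _).
rewrite -IH nprod_sumr eval_flatten; apply: eq_bigr => t _.
by rewrite eval_scale IH nprodZr.
Qed.

Let eval_normalize fuel e : eval_poly (normalize fuel e) = eval e.
Proof.
elim: e => [|a n e IH|e1 IH1 e2 IH2|c e IH] /=.
- by rewrite /eval_poly big_seq1 rmorph1 scale1r.
- rewrite -IH nprod_sumr eval_flatten; apply: eq_bigr => t _.
  by rewrite eval_scale eval_act /= enc_basisK nprodZr.
- by rewrite eval_cat IH1 IH2.
- by rewrite eval_scale IH.
Qed.

Let poly_eq0P n p : poly_eq0 n p -> eval_poly p = 0.
Proof.
elim: n p => [|n IH] [|t p] //; try by rewrite /eval_poly big_nil.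
rewrite -[poly_eq0 _ _]/((foldr (fun u c => u.1 + c) 0
  [seq u <- t :: p | u.2 == t.2] == 0)
  && poly_eq0 n [seq u <- t :: p | u.2 != t.2]).
move: (t :: p) => {}p /andP[/eqP H /IH].
rewrite {1}/eval_poly big_filter => E.
rewrite /eval_poly (bigID (fun u => u.2 == t.2)) /= E addr0; move: H.
rewrite (eq_bigr (fun u => ratr u.1 *: eval_word t.2)) => [|u /eqP -> //].
rewrite -scaler_suml -rmorph_sum -big_filter.
have sumE (s : poly) : \sum_(u <- s) u.1 = foldr (fun u c => u.1 + c) 0 s.
  by elim: s => [|u s IHs]; rewrite ?big_nil // big_cons IHs.
by rewrite sumE => ->; rewrite rmorph0 scale0r.
Qed.

Lemma expr_eqP e1 e2 : expr_eq e1 e2 -> eval e1 = eval e2.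
Proof.
move=> /poly_eq0P; rewrite eval_normalize /= rmorphN1 scaleN1r => /eqP.
by rewrite subr_eq0 => /eqP.
Qed.

End NormalOrdering.

(** * Degrees and singular vectors *)

Section Homomorphisms.
Variables (F : numFieldType) (V W : vertexSuperalgebra F) (f : V -> W).
Hypothesis hf : vertex_hom f.

Lemma vertex_homD u v : f (u + v) = f u + f v.
Proof. by case: hf => lin _ _ _; have := lin 1 u v; rewrite !scale1r. Qed.

Lemma vertex_hom0 : f 0 = 0.
Proof. by apply: (addrI (f 0)); rewrite -vertex_homD !addr0. Qed.

Lemma vertex_homZ (c : F) v : f (c *: v) = c *: f v.
Proof. by case: hf => lin _ _ _; have := lin c v 0; rewrite vertex_hom0 !addr0. Qed.

Lemma vertex_homB u v : f (u - v) = f u - f v.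
Proof. by rewrite vertex_homD -scaleN1r vertex_homZ scaleN1r. Qed.

Lemma vertex_hom_sum (I : Type) (r : seq I) (P : pred I) (t : I -> V) :
  f (\sum_(i <- r | P i) t i) = \sum_(i <- r | P i) f (t i).
Proof. by apply: (big_morph f); [exact: vertex_homD|exact: vertex_hom0]. Qed.

Lemma vertex_hom_vac : f vac = vac. Proof. by case: hf. Qed.

Lemma vertex_hom_nprod u n v : f (nprod u n v) = nprod (f u) n (f v).
Proof. by case: hf. Qed.

Lemma vertex_hom_generated (G : set V) v :
  generated_by G v -> generated_by (f @` G) (f v).
Proof.
move: v; apply: (@generated_by_sub _ V G (f @^-1` generated_by (f @` G))) => [|v Gv]; last first.
  by apply: sub_generated; exists v.
split; [split|..] => /=.
- by rewrite vertex_hom0; apply: (subsp0 (subspace_generated _)).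
- move=> c u v Hu Hv; rewrite vertex_homD vertex_homZ.
  by case: (subspace_generated (f @` G)) => _; apply.
- by rewrite vertex_hom_vac; apply: generated_vac.
- by move=> u n v Hu Hv; rewrite vertex_hom_nprod; apply: generated_nprod.
Qed.

End Homomorphisms.

(** * Rescaled fields and the degree operator *)

Section Rescaling.
Variables (F : numFieldType) (V : vertexSuperalgebra F).
Implicit Types (a b c u v : V) (n m l : int).

(* The field Y(a, 2z).  On V^k(g), the homomorphism to this vertex superalgebra
   given by universality acts as 2^d on the component of degree d. *)
Definition rescaled_nprod a n b : V := (2 : F) ^ (- n - 1) *: nprod a n b.

Lemma two_neq0 : (2 : F) != 0. Proof. by rewrite pnatr_eq0. Qed.

Let linl (c : F) a a' n b :
  rescaled_nprod (c *: a + a') n b = c *: rescaled_nprod a n b + rescaled_nprod a' n b.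
Proof. by rewrite /rescaled_nprod vs_linl scalerDr !scalerA mulrC. Qed.

Let linr (c : F) a n b b' :
  rescaled_nprod a n (c *: b + b') = c *: rescaled_nprod a n b + rescaled_nprod a n b'.
Proof. by rewrite /rescaled_nprod vs_linr scalerDr !scalerA mulrC. Qed.

Let homog_nprod p q a b n :
  homog p a -> homog q b -> homog (p (+) q) (rescaled_nprod a n b).
Proof. by move=> pa qb; apply/(subspZ (subspace_homog V _))/vs_homog_nprod. Qed.

Let truncation a b :
  exists N : int, forall n, N <= n -> rescaled_nprod a n b = 0.
Proof.
by have [N H] := vs_truncation a b; exists N => n /H; rewrite /rescaled_nprod => ->;
  rewrite scaler0.
Qed.

Let vacl n a : rescaled_nprod vac n a = if n == -1 then a else 0.
Proof.
rewrite /rescaled_nprod vs_vacl; case: eqP => [->|_]; last exact: scaler0.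
by rewrite opprK subrr expr0z scale1r.
Qed.

Let vacr a : rescaled_nprod a (-1) vac = a.
Proof. by rewrite /rescaled_nprod vs_vacr opprK subrr expr0z scale1r. Qed.

Let vacr0 a (n : nat) : rescaled_nprod a n%:Z vac = 0.
Proof. by rewrite /rescaled_nprod vs_vacr0 scaler0. Qed.

Let borcherds p q a b c m n l : homog p a -> homog q b ->
  exists N0 : nat, forall N : nat, (N0 <= N)%N ->
    \sum_(j < N) binz F m j *: rescaled_nprod (rescaled_nprod a (n + j%:Z) b) (m + l - j%:Z) c
    = \sum_(j < N) ((-1) ^+ j * binz F n j) *:
        (rescaled_nprod a (m + n - j%:Z) (rescaled_nprod b (l + j%:Z) c)
         - ((-1) ^ n * (-1) ^+ (p && q)) *:
             rescaled_nprod b (n + l - j%:Z) (rescaled_nprod a (m + j%:Z) c)).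
Proof.
move=> pa qb; have [N0 H] := @vs_borcherds F V p q a b c m n l pa qb.
(* In every term the indices of the two products add up to [m + n + l], so all terms acquire the
   same factor [d]. *)
exists N0 => N /H {}H; pose d := (2 : F) ^ (- (m + n + l) - 2).
have dE s t : s + t = m + n + l -> (2 : F) ^ (- s - 1) * 2 ^ (- t - 1) = d.
  by move=> st; rewrite -expfzDr ?two_neq0 //; congr (_ ^ _); lia.
transitivity (d *: \sum_(j < N) binz F m j *:
    nprod (nprod a (n + j%:Z) b) (m + l - j%:Z) c).
  rewrite scaler_sumr; apply: eq_bigr => j _.
  rewrite /rescaled_nprod nprodZl !scalerA -mulrA dE; last by lia.
  by rewrite mulrC.
rewrite H scaler_sumr; apply: eq_bigr => j _.
rewrite /rescaled_nprod !nprodZr !scalerA dE; last by lia.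
rewrite -[_ * _ * 2 ^ _ * 2 ^ _]mulrA dE; last by lia.
by rewrite !scalerBr !scalerA [d * _]mulrC; congr (_ - _ *: _); ring.
Qed.

Definition rescaled : vertexSuperalgebra F :=
  VertexSuperalgebra (@vs_homog0 F V) (@vs_homog_lin F V) (@vs_homog_split F V)
    (@vs_homog_disj F V) (@vs_homog_vac F V) homog_nprod linl linr truncation
    vacl vacr vacr0 borcherds.

End Rescaling.

Section DegreeOperator.
Variables (F : numFieldType) (g : lieSuperData F) (k : F).

(** The currents have degree one, hence the factor 2: the n-th product of [2 a] and [2 b] acquires
    [2 ^ (1 - n)], which is 2 on the bracket and 1 on the central term. *)
Lemma rescaled_affine (V : vertexSuperalgebra F) (J : g -> V) :
  affine_at_level k J ->
  @affine_at_level F g k (rescaled V) (fun a => 2 *: J a).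
Proof.
move=> [hom rel]; split=> [a|a b n].
  exact: (subspZ (subspace_homog V _)).
rewrite /= /rescaled_nprod nprodZl nprodZr rel !scalerA -[2 * 2]/((2 : F) ^ 2).
rewrite -expfzDr ?two_neq0 //; case: n => [|[|n]] /=.
- rewrite (_ : - 0%:Z - 1 + 2 = 1) // expr1z scaler_sumr.
  by apply: eq_bigr => t _; rewrite !scalerA mulrC.
- by rewrite (_ : - 1%:Z - 1 + 2 = 0) // expr0z scale1r.
- exact: scaler0.
Qed.

Lemma universal_degree_operator (V : vertexSuperalgebra F) (J : g -> V) :
  universal_affine k J ->
  exists theta : V -> V, [/\ linear_op theta, theta vac = vac
    & forall d v, degree J d v -> eigenvector theta (2 ^ d) v].
Proof.
move=> [hJ _ univ]; have [theta [hom thJ]] := univ _ _ (rescaled_affine hJ).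
exists theta; case: (hom) => lin thvac _ mul; split=> //.
move=> d v; elim=> {d v} [|a m d v _ IH|d|d c u v _ IHu _ IHv].
- by rewrite /eigenvector expr0z scale1r.
- rewrite /eigenvector mul thJ /= /rescaled_nprod IH nprodZl nprodZr !scalerA.
  congr (_ *: _); rewrite -{2}[2]expr1z -!expfzDr ?two_neq0 //.
  by congr (_ ^ _); lia.
- by rewrite /eigenvector scaler0; apply: (linop0 lin).
- exact: (proj2 (subspace_eigenvector lin _)).
Qed.

Variables (L : vertexSuperalgebra F) (J : g -> L).
Hypothesis hL : simple_affine k J.

Lemma simple_affine_at_level : affine_at_level k J.
Proof.
case: hL => V [JV [f [[[hom rel] _ _] [hf fJ] _ _ _]]]; split=> [a|a b n].
  by rewrite -fJ; case: hf => _ _ fh _; apply: fh.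
rewrite -!fJ -(vertex_hom_nprod hf) rel; case: n => [|[|n]].
- rewrite (vertex_hom_sum hf); apply: eq_bigr => t _.
  by rewrite (vertex_homZ hf) fJ.
- by rewrite (vertex_homZ hf) (vertex_hom_vac hf).
- exact: (vertex_hom0 hf).
Qed.

Lemma simple_affine_generated : generated_by (range J) = setT.
Proof.
case: hL => V [JV [f [[_ gen _] [hf fJ] fsurj _ _]]].
apply/seteqP; split=> // v _.
have [w _ <-] : range f v by rewrite fsurj.
have := vertex_hom_generated hf (_ : generated_by (range JV) w).
rewrite gen => /(_ I); apply: sub_smallest2r; first exact: generated_subalgebra.
by move=> _ [_ [a _ <-] <-]; rewrite fJ; exists a.
Qed.

(** The operator of the universal algebra descends because the kernel of the quotient map is graded:
    an element of it is a sum of eigenvectors in it. Distinct powers of 2 then separate the degrees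
    in [L]. *)
Lemma simple_degree_operator :
  exists theta : L -> L, [/\ linear_op theta, theta vac = vac
    & forall d v, degree J d v -> eigenvector theta (2 ^ d) v].
Proof.
case: hL => V [JV [f [univ [hf fJ] fsurj fker _]]].
have [th [lin thvac thdeg]] := universal_degree_operator univ.
have ker v : f v = 0 -> f (th v) = 0.
  move=> /fker[s -> Hs]; rewrite (linop_sum lin) (vertex_hom_sum hf).
  rewrite big_seq big1 // => u /Hs[fu [d /thdeg Hu] _].
  by rewrite Hu (vertex_homZ hf) fu scaler0.
have /choice[pre preK] : forall v, exists w, f w = v.
  by move=> v; have [w _ <-] : range f v by [rewrite fsurj]; exists w.
have thE w : f (th (pre (f w))) = f (th w).
  apply/eqP; rewrite -subr_eq0 -(vertex_homB hf) -(linopB lin); apply/eqP/ker.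
  by rewrite (vertex_homB hf) preK subrr.
have fsurj' v : exists w, v = f w by exists (pre v); rewrite preK.
exists (fun v => f (th (pre v))); split.
- move=> c u v; have [u' ->] := fsurj' u; have [v' ->] := fsurj' v.
  rewrite -(vertex_homZ hf) -(vertex_homD hf) !thE lin.
  by rewrite (vertex_homD hf) (vertex_homZ hf).
- by rewrite -(vertex_hom_vac hf) thE thvac.
- move=> d v dv.
  have [w dw ->] : exists2 w, degree JV d w & v = f w.
    elim: dv => {d v} [|a m d v _ [w dw ->]|d|d c u v _ [u' du ->] _ [v' dv ->]].
    + by exists vac; [exact: degree_vac|rewrite (vertex_hom_vac hf)].
    + exists (nprod (JV a) m w); first exact: degree_mode.
      by rewrite (vertex_hom_nprod hf) fJ.
    + by exists 0; [exact: degree_zero|rewrite (vertex_hom0 hf)].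
    + exists (c *: u' + v'); first exact: degree_lin.
      by rewrite (vertex_homD hf) (vertex_homZ hf).
  by rewrite /eigenvector thE (thdeg _ _ dw) (vertex_homZ hf).
Qed.

Lemma degree_transl d v : degree J d v -> degree J (d + 1) (transl v).
Proof.
elim=> {d v} [|a m d v dv IH|d|d c u v _ IHu _ IHv].
- by rewrite transl_vac; apply: degree_zero.
- rewrite transl_derivation transl_mode; apply: degree_lin.
    rewrite (_ : d - m + 1 = d - (m - 1)); last by lia.
    exact: degree_mode.
  rewrite (_ : d - m + 1 = d + 1 - m); last by lia.
  exact: degree_mode.
- by rewrite transl0; apply: degree_zero.
- by rewrite translD translZ; apply: degree_lin.
Qed.

Lemma pbw_transl B : (forall d p v, B d p v -> B (d + 1) p (transl v)) ->
  forall d p v, pbw J B d p v -> pbw J B (d + 1) p (transl v).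
Proof.
move=> hB d p v; elim=> {d p v} [d p v /hB Bv|a m d p v Pv IH|d p|d p c u v _ IHu _ IHv].
- exact: pbw_base.
- rewrite transl_derivation transl_mode; apply: pbw_lin.
    rewrite (_ : d - Negz m + 1 = d - Negz m.+1); last by lia.
    by rewrite (_ : Negz m - 1 = Negz m.+1); [exact: pbw_neg|lia].
  rewrite (_ : d - Negz m + 1 = d + 1 - Negz m); last by lia.
  exact: pbw_neg.
- by rewrite transl0; apply: pbw_zero.
- by rewrite translD translZ; apply: pbw_lin.
Qed.

Hypothesis br_parity :
  forall a b : g, all (fun t => lie_odd t.2 == lie_odd a (+) lie_odd b) (lie_br a b).
Hypothesis form_parity : forall a b : g, lie_odd a != lie_odd b -> lie_form a b = 0.

Lemma simple_affine_vac_neq0 : (vac : L) <> 0.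
Proof. by case: hL => V [JV [f [_ _ _ _ []]]]. Qed.

Lemma two_expz_neq1 (d : int) : 0 < d -> (2 : F) ^ d != 1.
Proof.
case: d => [[|n]|n] // _; rewrite -exprnP -natrX (eqr_nat _ _ 1).
by rewrite -[1%N in X in _ != X](expn0 2) eqn_exp2l.
Qed.

(* It generates an ideal in degrees at least d, which does not contain vac. *)
Lemma singular_vector_eq0 d p w : 0 < d -> degree J d w -> homog p w ->
  (forall a (n : nat), nprod (J a) n%:Z w = 0) -> w = 0.
Proof.
move=> d0 dw pw w0.
have hJ := simple_affine_at_level.
(* The derivatives of [w] are singular as well, by [a(n), D] = n a(n - 1). Including them makes the
   span stable under D, and skew-symmetry then turns the left ideal into a two-sided one. *)
pose B (d' : int) (p' : bool) : set L :=
  [set v | exists i : nat, [/\ d' = d + i%:Z, p' = p & v = iter i (@transl F L) w]].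
have Bvac d' p' v : B d' p' v -> forall a (n : nat), nprod (J a) n%:Z v = 0.
  move=> [i [_ _ ->]]; elim: i => [|i IH] a n //=.
  have := transl_derivation (J a) n%:Z (iter i (@transl F L) w).
  rewrite IH transl0 transl_mode; case: n => [|n].
    by rewrite mulr0z oppr0 scale0r add0r => <-.
  by rewrite (_ : n.+1%:Z - 1 = n%:Z) ?IH ?scaler0 ?add0r => [<-|]; last lia.
have Bdeg d' p' v : B d' p' v -> degree J d' v.
  move=> [i [-> _ ->]]; elim: i => [|i IH]; first by rewrite addr0.
  by rewrite -addn1 PoszD addrA addn1; apply: degree_transl.
have Bhom d' p' v : B d' p' v -> homog p' v.
  by move=> [i [_ -> ->]]; elim: i => [//|i IH]; apply: transl_homog.
have Btr d' p' v : B d' p' v -> B (d' + 1) p' (transl v).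
  move=> [i [-> -> ->]]; exists i.+1; split=> //; lia.
have Bge d' p' v : B d' p' v -> d <= d' by move=> [i [-> _ _]]; lia.
pose I := pbw_span J B; have hI : subspace I := subspace_pbw_span J B.
have gen u : generated_by (range J) u by rewrite simple_affine_generated.
have Il u : preserves I u by apply: (generated_pbw_preserved hJ).
have Itr v : I v -> I (transl v).
  apply: (sums_linop (@linear_op_transl F L)) => u [d' [p' Pu]].
  by apply: sums1; exists (d' + 1), p'; apply: pbw_transl.
have Ir u n v : I v -> I (nprod v n u).
  move=> Iv; elim/homog_split_ind: u => [u1 u2 H1 H2|q u qu].
    by rewrite nprodDr; apply: (subspD hI).
  apply: (sums_linop (T := fun v => nprod v n u) _ _ Iv).
    by move=> c v1 v2; rewrite nprodDl nprodZl.
  move=> v' [d' [p' Pv]].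
  have [N H] := skew_symmetry n qu (pbw_homog hJ Bhom Pv).
  have {H} := H N (leqnn _); set s := (X in X *: _).
  have s0 : s != 0 by rewrite mulf_neq0 // ?signr_eq0 // expfz_neq0 // oppr_eq0 oner_eq0.
  move=> E; rewrite -[nprod v' n u](scalerK s0) E.
  apply: (subspZ hI); apply: (subspN hI); apply: (subsp_sum hI) => j _.
  apply: (subspZ hI); apply: transl_closed_mode_vac => //.
  by apply: Il; apply: sums1; exists d', p'.
have [V [JV [f [_ _ _ _ [_ simp]]]]] := hL.
have [|||I0] := simp I.
- by split=> // u n v Iv; split; [exact: Il|exact: Ir].
- move=> v [s vs Hs]; exists s => // u /Hs[d' [p' Pu]]; split.
  + by apply: sums1; exists d', p'.
  + by exists d'; apply: (pbw_degree Bdeg Pu).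
  + by exists p'; apply: (pbw_homog hJ Bhom Pu).
- have : I w by apply: sums1; exists d, p; apply: pbw_base; exists 0%N; rewrite addr0.
  by move=> + I0; rewrite I0.
- have [th [lin thvac thdeg]] := simple_degree_operator.
  have : I vac by rewrite I0.
  case=> s vs Hs; case: simple_affine_vac_neq0.
  apply: (eigenvector_sum_eq0 lin (mu := 1) _ vs); first by rewrite /eigenvector scale1r.
  move=> u /Hs[d' [p' Pu]]; have [dd|->] := pbw_degree_ge Bge Pu.
    exists (2 ^ d'); first by apply: two_expz_neq1; lia.
    exact/thdeg/(pbw_degree Bdeg Pu).
  exists 0; first by rewrite eq_sym oner_eq0.
  by rewrite /eigenvector scaler0; apply: (linop0 lin).
Qed.

End DegreeOperator.

(** * The Heisenberg vertex subalgebra *)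

Section Heisenberg.
Variables (F : numFieldType) (V : vertexSuperalgebra F) (h : V) (kappa : F).
Implicit Types (u v w : V) (m n : int).
Hypotheses (kappa0 : kappa != 0) (h_even : homog false h).
Hypothesis h_ope : forall n : nat,
  nprod h n%:Z h = match n with 1%N => kappa *: vac | _ => 0 end.

Lemma heisenberg_commutator m n v :
  nprod h m (nprod h n v) =
    nprod h n (nprod h m v) + (if m + n == 0 then m%:~R * kappa else 0) *: v.
Proof.
rewrite (@even_commutator_trunc F V 2) //; last by move=> [|[|j]] // _; rewrite h_ope.
rewrite !big_ord_recl big_ord0 /= (h_ope 0) (h_ope 1) nprod0l scaler0 add0r addr0.
rewrite binz1 nprodZl vs_vacl scalerA; congr (_ + _).
rewrite (_ : (m + n - _ == -1) = (m + n == 0)); last by rewrite /bump /=; lia.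
by case: ifP; rewrite ?scale0r ?scaler0.
Qed.

(** The zero mode of the Virasoro field of the Heisenberg algebra. It satisfies [heis_degree, h(n)]
    = - n h(n) and vanishes on [parafermion h], so on [heis_poly] it counts the degree in the
    creation modes. *)
Definition heis_degree v : V := (2 * kappa)^-1 *: nprod (nprod h (-1) h) 1 v.

Lemma linear_op_heis_degree : linear_op heis_degree.
Proof. by move=> c u v; rewrite /heis_degree vs_linr scalerDr !scalerA mulrC. Qed.

Lemma heis_degree_mode n v :
  heis_degree (nprod h n v) = nprod h n (heis_degree v) - n%:~R *: nprod h n v.
Proof.
have hq (j : nat) : nprod h j (nprod h (-1) h) = if j == 1%N then (2 * kappa) *: h else 0.
  rewrite heisenberg_commutator (h_ope j); case: j => [|[|j]].
  - by rewrite nprod0r scale0r addr0.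
  - by rewrite /= nprodZr vs_vacr mul1r -scalerDl; congr (_ *: _); ring.
  - rewrite nprod0r add0r (_ : (j.+2%:Z + -1 == 0) = false) ?scale0r //; lia.
have k2 : 2 * kappa != 0 by rewrite mulf_neq0 // pnatr_eq0.
rewrite {2}/heis_degree nprodZr.
rewrite (@even_commutator_trunc F V 2 h (nprod h (-1) h)) //; last first.
  by move=> [|[|j]] // _; rewrite hq.
rewrite !big_ord_recl big_ord0 /= !hq /= nprod0l scaler0 add0r addr0 binz1 nprodZl.
rewrite scalerDr -/(heis_degree _) !scalerA mulrAC mulVf // mul1r.
by rewrite (_ : n + 1 - _ = n) ?addrK // /bump /=; lia.
Qed.

(** In the normally ordered expansion a positive mode of [h] acts first on [v] in each term, apart
    from h(0)h(0)v, which vanishes. *)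
Lemma heis_degree_formula (S : set V) v : subspace S ->
  (forall n (m : nat), S (nprod h n (nprod h m.+1%:Z v))) ->
  nprod h 0 v = 0 -> S (heis_degree v).
Proof.
move=> hS Sh h0; have [N H] := normal_product_formula v 1 h_even h_even.
rewrite /heis_degree (H N) //; apply: (subspZ hS); apply: (subsp_sum hS) => -[[|j] jN] _ /=.
  by rewrite scale1r h0 nprod0r addr0; apply: (Sh _ 0%N).
rewrite scale1r; apply: (subspD hS); last exact: Sh.
by rewrite (_ : 1 + j.+1%:Z = j.+2%:Z) //; lia.
Qed.

Lemma parafermion_heis_degree v : parafermion h v -> heis_degree v = 0.
Proof.
move=> Nv; have S0 : subspace [set 0 : V].
  by split=> // c x y -> ->; rewrite scaler0 addr0.
apply: (heis_degree_formula S0) => [n m|]; last exact: (Nv 0%N).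
by rewrite Nv nprod0r.
Qed.

(** A commutant: if all [h_(j) u] with [j >= 0] vanish, the commutator formula has no terms and h(n)
    commutes with every mode of [u]. *)
Lemma parafermion_subalgebra : vertex_subalgebra (parafermion h).
Proof.
split; [split|..].
- by move=> n; rewrite nprod0r.
- by move=> c u v Nu Nv n; rewrite vs_linr Nu Nv scaler0 addr0.
- by move=> n; rewrite vs_vacr0.
- move=> u m v Nu Nv n; rewrite (@even_commutator_trunc F V 0) //.
  by rewrite big_ord0 Nv nprod0r addr0.
Qed.

Section Polynomials.
Variable A : set V.
Hypotheses (hA : vertex_subalgebra A) (A_even : A `<=` homog false).
Hypothesis AN : A `<=` parafermion h.

(** Polynomials in the creation modes of [h] with coefficients in [A]; the index is their eigenvalue
    under [heis_degree]. *)
Inductive heis_poly : nat -> set V :=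
| heis_base v : A v -> heis_poly 0 v
| heis_mode (m : nat) d v : heis_poly d v -> heis_poly (d + m.+1) (nprod h (Negz m) v)
| heis_zero d : heis_poly d 0
| heis_lin d c u v : heis_poly d u -> heis_poly d v -> heis_poly d (c *: u + v).

Let hAs : subspace A. Proof. by case: hA. Qed.

Lemma subspace_heis_poly d : subspace (heis_poly d).
Proof. by split=> [|c u v]; [exact: heis_zero|exact: heis_lin]. Qed.

Lemma heis_poly0 v : heis_poly 0 v -> A v.
Proof.
move E : 0%N => d H; elim: H E => {d v} [//|m d v _ _|d _|d c u v _ IHu _ IHv E].
- by rewrite addnS.
- exact: (subsp0 hAs).
- by case: hAs => _; apply; [exact: IHu|exact: IHv].
Qed.

Lemma heis_poly_eigenvector d v : heis_poly d v -> eigenvector heis_degree d%:R v.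
Proof.
have lin := linear_op_heis_degree.
elim=> {d v} [v /AN/parafermion_heis_degree Tv|m d v _ IH|d|d c u v _ IHu _ IHv].
- by rewrite /eigenvector Tv scale0r.
- rewrite /eigenvector heis_degree_mode IH nprodZr -scalerBl; congr (_ *: _).
  by rewrite NegzE mulrNz opprK natrD.
- exact: (subsp0 (subspace_eigenvector lin _)).
- exact: (proj2 (subspace_eigenvector lin _)).
Qed.

Definition heis_span : set V := sums [set v | exists d, heis_poly d v].

Lemma subspace_heis_span : subspace heis_span.
Proof.
apply: subspace_sums => c v [d Pv]; exists d.
exact: (subspZ (subspace_heis_poly d)).
Qed.

Lemma heis_span_mode : preserves heis_span h.
Proof.
have hS := subspace_heis_span.
have neg (m : nat) v : heis_span v -> heis_span (nprod h (Negz m) v).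
  apply: (sums_linop (linear_op_mode h _)) => u [d Pu].
  by apply: sums1; exists (d + m.+1)%N; apply: heis_mode.
move=> [n|n] v; last exact: neg.
apply: (sums_linop (linear_op_mode h _)) => u [d Pu].
elim: Pu => {d u} [u /AN Nu|m d u Pu IH|d|d c u w _ IHu _ IHw].
- by rewrite Nu; apply: (subsp0 hS).
- rewrite heisenberg_commutator; apply: (subspD hS); first exact: neg.
  by apply: (subspZ hS); apply: sums1; exists d.
- by rewrite nprod0r; apply: (subsp0 hS).
- by rewrite vs_linr; case: hS => _; apply.
Qed.

Lemma heis_span_algebra a : A a -> preserves heis_span a.
Proof.
have hS := subspace_heis_span.
move=> Aa n v; apply: (sums_linop (linear_op_mode a _)) => u [d Pu].
elim: Pu => {d u} [u Au|m d u Pu IH|d|d c u w _ IHu _ IHw].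
- by apply: sums1; exists 0%N; apply: heis_base; case: hA => _ _; apply.
- have := @even_commutator_trunc F V 0 h a u (Negz m) n h_even.
  rewrite big_ord0 addr0 => <-; first exact: heis_span_mode.
  by move=> j _; apply: AN.
- by rewrite nprod0r; apply: (subsp0 hS).
- by rewrite vs_linr; case: hS => _; apply.
Qed.

Definition heis_algebra : set V := generated_by (h |` A).

Lemma heis_algebra_span : heis_algebra `<=` heis_span.
Proof.
apply: generated_module => [|||g].
- exact: subspace_heis_span.
- by apply: sums1; exists 0%N; apply: heis_base; case: hA.
- by move=> g [->|/A_even]; exists false.
- by move=> [->|]; [exact: heis_span_mode|exact: heis_span_algebra].
Qed.

Lemma heis_poly_algebra d v : heis_poly d v -> heis_algebra v.
Proof.
have hS := subspace_generated (h |` A).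
elim=> {d v} [v Av|m d v _ IH|d|d c u v _ IHu _ IHv].
- by apply: sub_generated; right.
- by apply: generated_nprod => //; apply: sub_generated; left.
- exact: (subsp0 hS).
- by case: hS => _; apply.
Qed.

Lemma heis_span_split v : heis_span v ->
  exists2 a, A a & sums [set u | exists d, heis_poly d.+1 u] (v - a).
Proof.
case=> s -> Hs; elim: s Hs => [|u s IH] Hs.
  by exists 0; [exact: (subsp0 hAs)|rewrite big_nil subr0; apply: sums0].
have [|a Aa Sa] := IH; first by move=> w ws; apply: Hs; rewrite inE ws orbT.
rewrite big_cons; have [[|d] Pu] := Hs u (mem_head _ _).
  exists (u + a); first by apply: (subspD hAs) => //; apply: heis_poly0.
  by rewrite opprD addrACA subrr add0r.
exists a => //; rewrite -addrA; apply: sumsD => //.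
by apply: sums1; exists d.
Qed.

(** The algebra generated by [h] and [A] is graded by [heis_degree] with part [A] in degree 0, and
    [heis_degree] kills the commutant of [h]. *)
Lemma heis_algebra_parafermion v : heis_algebra v -> parafermion h v -> A v.
Proof.
move=> /heis_algebra_span/heis_span_split[a Aa Sa] Nv.
rewrite (@eigenvector_component F V heis_degree 0 v a) //.
- exact: linear_op_heis_degree.
- by rewrite /eigenvector parafermion_heis_degree // scale0r.
- by rewrite /eigenvector parafermion_heis_degree ?scale0r //; apply: AN.
- apply: sumsS Sa => u [d /heis_poly_eigenvector Tu]; exists d.+1%:R => //.
  by rewrite pnatr_eq0.
Qed.

(* A vector v of weight 0 is corrected by an element of C = heis_algebra so that
   heis_degree v lies in A; then the vectors h(n) v, n > 0, are in C and have the
   eigenvalue - n, hence vanish. *)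
Lemma heis_completeness (K : nat -> set V) :
  (forall d, subspace (K d)) ->
  (forall d v, K d v -> parafermion h v -> A v) ->
  (forall v, heis_algebra v -> exists d, K d v) ->
  (forall d d' v, (d <= d')%N -> K d v -> K d' v) ->
  (forall d (n : nat) v, (0 < n <= d)%N -> K d v -> K (d - n)%N (nprod h n%:Z v)) ->
  (forall d (n : nat) v, (d < n)%N -> K d v -> nprod h n%:Z v = 0) ->
  forall d v, K d v -> nprod h 0 v = 0 -> heis_algebra v.
Proof.
move=> Ks KA CK Kmono Kn K0 d; have [n] := ubnP d; elim: n d => // n IH d dn v Kv h0v.
have hC := subspace_generated (h |` A).
have Ch : heis_algebra h by apply: sub_generated; left.
have h0 m u : nprod h 0 (nprod h m u) = nprod h m (nprod h 0 u).
  rewrite heisenberg_commutator; case: ifP; rewrite ?scale0r ?addr0 // => _.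
  by rewrite mulr0z mul0r scale0r addr0.
(* Positive modes lower the filtration index and preserve the weight zero, so the induction
   hypothesis applies to h(m + 1) v. *)
have Cn (m : nat) : heis_algebra (nprod h m.+1%:Z v).
  case: (leqP m.+1 d) => md; last by rewrite (K0 d) //; apply: (subsp0 hC).
  apply: (IH (d - m.+1)%N); [lia|exact: Kn|].
  by rewrite h0 h0v nprod0r.
have CT : heis_algebra (heis_degree v).
  by apply: (heis_degree_formula hC) => [m j|//]; exact: (generated_nprod _ Ch (Cn j)).
have [a Aa Sa] := heis_span_split (heis_algebra_span CT).
have lin := linear_op_heis_degree.
(* Each component of positive degree is divided by its eigenvalue [e.+1]; the component of degree 0,
   on which [heis_degree] is not invertible, is the [a] left over. *)
have [r Cr Tr] : exists2 r, heis_algebra r & heis_degree r = heis_degree v - a.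
  case: Sa => s -> {CT a Aa} Hs; elim: s Hs => [|u s IHs] Hs.
    by exists 0; [exact: (subsp0 hC)|rewrite (linop0 lin) big_nil].
  have [|r Cr Tr] := IHs; first by move=> w ws; apply: Hs; rewrite inE ws orbT.
  have [e Pu] := Hs u (mem_head _ _); exists (e.+1%:R^-1 *: u + r).
    by apply: (subspD hC) => //; apply: (subspZ hC); apply: heis_poly_algebra Pu.
  rewrite lin Tr big_cons (heis_poly_eigenvector Pu) scalerA mulVf ?scale1r //.
  by rewrite pnatr_eq0.
have C0 u : heis_algebra u -> nprod h 0 u = 0.
  move=> /heis_algebra_span [s -> Hs]; rewrite nprod_sumr big_seq big1 // => w /Hs[e Pw].
  elim: Pw => {w e} [w /AN|m e w _ IHw|e|e c w1 w2 _ I1 _ I2].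
  - by apply.
  - by rewrite h0 IHw nprod0r.
  - exact: nprod0r.
  - by rewrite vs_linr I1 I2 scaler0 addr0.
have TA : heis_degree (v - r) = a.
  by rewrite (linopB lin) Tr opprB addrCA subrr addr0.
suff Nv : parafermion h (v - r).
  rewrite -(subrK r v); apply: (subspD hC) => //.
  apply: sub_generated; right; have [d' Kr] := CK r Cr.
  apply: (KA (maxn d d')) => //; apply: (subspB (Ks _)).
    exact: Kmono (leq_maxl _ _) Kv.
  exact: Kmono (leq_maxr _ _) Kr.
move=> [|m]; first by rewrite nprodBr h0v C0 // subrr.
have Cm : heis_algebra (nprod h m.+1%:Z (v - r)).
  by rewrite nprodBr; apply: (subspB hC) (Cn m) _; apply: generated_nprod Ch Cr.
have [s sE Hs] := heis_algebra_span Cm.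
apply: (eigenvector_sum_eq0 lin (mu := - m.+1%:R) _ sE).
  by rewrite /eigenvector heis_degree_mode TA (AN Aa) sub0r scaleNr.
move=> u /Hs[e Pu]; exists e%:R; last exact: heis_poly_eigenvector.
by rewrite -subr_eq0 opprK -natrD pnatr_eq0 addnS.
Qed.

End Polynomials.

End Heisenberg.

(** * The derivation E and the vectors Z *)

Declare Scope expr_scope.
Delimit Scope expr_scope with X.
Bind Scope expr_scope with expr.
Notation "a _[ n ] v" := (EMode a n%Z v) (at level 24, right associativity) : expr_scope.
Notation "u + v" := (EAdd u v) : expr_scope.
Notation "u - v" := (EAdd u (EScale (-1)%R v)) : expr_scope.
Notation "c ** u" := (EScale c%R u) (at level 25, right associativity) : expr_scope.
Notation "1" := EVac : expr_scope.

Section Expressions.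
Local Notation e := (osp12_even sl2_e).
Notation f := (osp12_even sl2_f).
Notation h := (osp12_even sl2_h).
Notation x := osp12_x.
Notation y := osp12_y.

Definition zero_expr : expr := 0 ** 1.

Definition omega_expr : expr :=
  e _[-1] f _[-1] 1 + f _[-1] e _[-1] 1 + (1 / 2) ** h _[-1] h _[-1] 1.

(* The Sugawara vector of osp(1|2) up to scaling, which is singular because the
   level -3/2 is critical. *)
Definition casimir_expr : expr :=
  omega_expr - x _[-1] y _[-1] 1 + (1 / 2) ** h _[-2] 1.

(* E x and E y, for the derivation E = outer below *)
Definition x'_expr : expr := x _[-2] 1 - h _[-1] x _[-1] 1 + 2 ** e _[-1] y _[-1] 1.

Definition y'_expr : expr := y _[-2] 1 + h _[-1] y _[-1] 1 + 2 ** f _[-1] x _[-1] 1.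

Definition singular_expr : expr := x _[-2] x _[-1] 1 + x _[-1] x'_expr.

Fixpoint transl_expr (u : expr) : expr :=
  match u with
  | EVac => zero_expr
  | EMode a n u => (- n%:~R) ** a _[n - 1] u + a _[n] transl_expr u
  | EAdd u v => transl_expr u + transl_expr v
  | EScale c u => c ** transl_expr u
  end.

(** A boolean certificate that all terms have degree [d] and parity [p]. Evaluating it yields the
    parity, the degree and the vanishing of high modes. *)
Fixpoint expr_pbw (u : expr) (d : int) (p : bool) : bool :=
  match u with
  | EVac => (d == 0) && ~~ p
  | EMode a n u => expr_pbw u (d + n) (osp12_odd a (+) p)
  | EAdd u v => expr_pbw u d p && expr_pbw v d p
  | EScale _ u => expr_pbw u d p
  end.

Fixpoint expr_even (u : expr) : bool :=
  match u with
  | EVac => true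
  | EMode a n u => ~~ osp12_odd a && expr_even u
  | EAdd u v => expr_even u && expr_even v
  | EScale _ u => expr_even u
  end.

Variables (F : numFieldType) (L : vertexSuperalgebra F) (J : osp12 F -> L).
Hypothesis hJ : affine_at_level (- (3 / 2)) J.

Lemma eval_transl u : eval J (transl_expr u) = transl (eval J u).
Proof.
elim: u => [|a n u IH|u IHu v IHv|c u IH] /=.
- by rewrite rmorph0 scale0r transl_vac.
- by rewrite transl_derivation transl_mode IH rmorphN /= ratr_int.
- by rewrite IHu IHv translD.
- by rewrite IH translZ.
Qed.

Definition vac_base (d : int) (p : bool) : set L :=
  [set v | [/\ d = 0, p = false & v = vac]].

Lemma vac_base_annihilated d p v : vac_base d p v ->
  forall a (n : nat), nprod (J a) n%:Z v = 0.
Proof. by move=> [_ _ ->] a n; apply: vs_vacr0. Qed.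

Lemma eval_pbw u d p : expr_pbw u d p -> pbw J vac_base d p (eval J u).
Proof.
elim: u d p => [|a n u IH|u IHu v IHv|c u IH] d p /=.
- by move=> /andP[/eqP -> /negPf ->]; apply: pbw_base.
- move=> /IH Pu.
  have := pbw_mode hJ (@osp12_br_parity F) (@osp12_form_parity F) vac_base_annihilated Pu a n.
  by rewrite addrK /= addbA addbb addFb.
- move=> /andP[/IHu Pu /IHv Pv].
  exact: (subspD (subspace_pbw J vac_base d p)).
- by move=> /IH Pu; apply: (subspZ (subspace_pbw J vac_base d p)).
Qed.

Lemma eval_homog u d p : expr_pbw u d p -> homog p (eval J u).
Proof.
move=> /eval_pbw; apply: (pbw_homog hJ) => {}d {}p v [_ -> ->].
exact: vs_homog_vac.
Qed.

(** The result would have the negative degree [d - n]. *)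
Lemma eval_high_mode u d p : expr_pbw u d p ->
  forall a (n : nat), d < n%:Z -> nprod (J a) n%:Z (eval J u) = 0.
Proof.
move=> /eval_pbw Pu a n dn.
have Pn := pbw_mode hJ (@osp12_br_parity F) (@osp12_form_parity F)
  vac_base_annihilated Pu a n.
have base d' p' v : vac_base d' p' v -> 0 <= d' by case=> ->.
by case: (pbw_degree_ge base Pn) => // ?; lia.
Qed.

Lemma eval_degree u d p : expr_pbw u d p -> degree J d (eval J u).
Proof.
move=> /eval_pbw; apply: pbw_degree => {}d {}p v [-> _ ->].
exact: degree_vac.
Qed.

Lemma eval0 : eval J zero_expr = 0.
Proof. by rewrite /= rmorph0 scale0r. Qed.

Lemma eval_sub u v : eval J (u - v)%X = eval J u - eval J v.
Proof. by rewrite /= rmorphN1 scaleN1r. Qed.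

(* the conditions n <= 2 are those that are not clear for degree reasons *)
Lemma casimir_singular a (n : nat) : nprod (J a) n%:Z (eval J casimir_expr) = 0.
Proof.
case: (leqP n 2) => n2; last first.
  by apply: (@eval_high_mode _ 2 false); [vm_compute|lia].
rewrite -[LHS]/(eval J (a _[n] casimir_expr)) -eval0; apply: (expr_eqP hJ).
by case: n n2 => [|[|[|]]] //; case: a => [[]| |]; vm_compute.
Qed.

End Expressions.

(** * The Sugawara operator of sl(2) on the odd currents and the derivation E *)

Section CriticalLevel.
Local Notation e := (osp12_even sl2_e).
Local Notation f := (osp12_even sl2_f).
Local Notation h := (osp12_even sl2_h).
Local Notation x := osp12_x.
Local Notation y := osp12_y.

Variables (F : numFieldType) (L : vertexSuperalgebra F) (J : osp12 F -> L).
Hypothesis hJ : affine_at_level (- (3 / 2)) J.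
Implicit Types (u v w : L) (n m : int).

Local Notation omega := (eval J omega_expr).
Local Notation x' := (eval J x'_expr).
Local Notation y' := (eval J y'_expr).

(** Equality modulo the relation S = 0: [w] is the descendant of [casimir_expr] by which the two
    sides differ. *)
Lemma expr_eq_mod (u v w : expr) : eval J w = 0 -> expr_eq u (v + w) -> eval J u = eval J v.
Proof.
move=> w0 /(expr_eqP hJ) ->; rewrite -[LHS]/(eval J v + eval J w).
by rewrite w0 addr0.
Qed.

Let hom := affine_homog hJ.

Lemma omega_even : homog false omega.
Proof. by apply: (eval_homog hJ (d := 2)); vm_compute. Qed.

Lemma x'_odd : homog true x'.
Proof. by apply: (eval_homog hJ (d := 2)); vm_compute. Qed.

Lemma y'_odd : homog true y'.
Proof. by apply: (eval_homog hJ (d := 2)); vm_compute. Qed.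

Lemma mode_omega a (n : nat) : (1 < n)%N -> nprod (J a) n omega = 0.
Proof.
move=> n1; case: (leqP n 2) => n2; last first.
  by apply: (eval_high_mode hJ (d := 2) (p := false)); [vm_compute|lia].
have -> : n = 2%N by lia.
rewrite -[LHS]/(eval J (a _[2] omega_expr)) -(eval0 J); apply: (expr_eqP hJ).
by case: a => [[]| |]; vm_compute.
Qed.

(** Skew-symmetry puts the current on the left, so that the right side consists of expressions that
    normal ordering can evaluate. *)
Lemma omega_0 a : nprod omega 0 (J a) = transl (nprod (J a) 1 omega) - nprod (J a) 0 omega.
Proof. exact: skew_mode0 (hom a) omega_even (mode_omega a). Qed.

Lemma omega_1 a : nprod omega 1 (J a) = nprod (J a) 1 omega.
Proof. exact: skew_mode1 (hom a) omega_even (mode_omega a). Qed.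

Lemma omega_0_even a : nprod omega 0 (J (osp12_even a)) = transl (J (osp12_even a)).
Proof.
rewrite omega_0 -[J _ in RHS]vs_vacr -[nprod _ 1 _]/(eval J (_ _[1] omega_expr)).
rewrite -[nprod _ 0 _]/(eval J (_ _[0] omega_expr)).
rewrite -[nprod _ (-1) _]/(eval J (osp12_even a _[-1] 1)) -!eval_transl -eval_sub.
by apply: (expr_eqP hJ); case: a; vm_compute.
Qed.

(** The currents x and y form a doublet of vectors killed by the positive modes of sl(2). On such
    vectors [omega_(0)] is the Knizhnik-Zamolodchikov operator 2 e(-1) f(0) + 2 f(-1) e(0) + h(-1)
    h(0), the factor being 1/(k + 2) = 2. *)
Lemma omega_0_x : nprod omega 0 (J x) = nprod (J h) (-1) (J x) - 2 *: nprod (J e) (-1) (J y).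
Proof.
rewrite omega_0 -[nprod _ 1 _]/(eval J (_ _[1] omega_expr)).
rewrite -[nprod _ 0 _]/(eval J (_ _[0] omega_expr)) -!eval_transl -eval_sub.
rewrite (expr_eqP hJ (e2 := h _[-1] x _[-1] 1 - 2 ** e _[-1] y _[-1] 1)) /=.
  by rewrite !vs_vacr rmorphN1 rmorph_nat scaleN1r.
by vm_compute.
Qed.

Lemma omega_0_y :
  nprod omega 0 (J y) = - nprod (J h) (-1) (J y) - 2 *: nprod (J f) (-1) (J x).
Proof.
rewrite omega_0 -[nprod _ 1 _]/(eval J (_ _[1] omega_expr)).
rewrite -[nprod _ 0 _]/(eval J (_ _[0] omega_expr)) -!eval_transl -eval_sub.
rewrite (expr_eqP hJ (e2 := (-1) ** h _[-1] y _[-1] 1 - 2 ** f _[-1] x _[-1] 1)) /=.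
  by rewrite !vs_vacr rmorphN1 rmorph_nat !scaleN1r.
by vm_compute.
Qed.

(** The weight is j(j + 1)/(k + 2) with j = 1/2 and k + 2 = 1/2; the degree of x is 1. *)
Lemma omega_1_x : nprod omega 1 (J x) = (3 / 2) *: J x.
Proof.
rewrite omega_1 -[LHS]/(eval J (_ _[1] omega_expr)).
rewrite (expr_eqP hJ (e2 := (3 / 2) ** x _[-1] 1)) /=.
  by rewrite vs_vacr fmorph_div !rmorph_nat.
by vm_compute.
Qed.

(* The generator of the outer sl(2): omega_(0) is a translation operator on the
   vertex subalgebra of sl(2), but not on L. *)
Definition outer v : L := transl v - nprod omega 0 v.

Lemma linear_op_outer : linear_op outer.
Proof. exact: linear_op_sub (@linear_op_transl F L) (linear_op_mode omega 0). Qed.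

Lemma outer_homog p v : homog p v -> homog p (outer v).
Proof.
move=> pv; apply: (subspB (subspace_homog L p)); first exact: transl_homog.
exact: (vs_homog_nprod 0 omega_even pv).
Qed.

Lemma outer_derivation u n v :
  outer (nprod u n v) = nprod (outer u) n v + nprod u n (outer v).
Proof.
rewrite /outer transl_derivation (even_mode0_derivation _ _ _ omega_even).
by rewrite nprodBl nprodBr opprD addrACA.
Qed.

Lemma outer_even a : outer (J (osp12_even a)) = 0.
Proof. by rewrite /outer omega_0_even subrr. Qed.

Lemma outer_vac : outer vac = 0.
Proof. by rewrite /outer transl_vac (vs_vacr0 _ 0) subrr. Qed.

Definition sl2_subalgebra : set L := generated_by (range (J \o @osp12_even)).

Lemma subspace_sl2 : subspace sl2_subalgebra.
Proof. exact: subspace_generated. Qed.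

Lemma sl2_mode a n v : sl2_subalgebra v -> sl2_subalgebra (nprod (J (osp12_even a)) n v).
Proof. by apply: generated_nprod; apply: sub_generated; exists a. Qed.

Lemma sl2_even v : sl2_subalgebra v -> homog false v.
Proof. by apply: generated_even => _ [a _ <-]; apply: (hom (osp12_even a)). Qed.

Lemma sl2_expr (u : expr) : expr_even u -> sl2_subalgebra (eval J u).
Proof.
elim: u => [|[a| |] n u IH|u IHu v IHv|c u IH] //=.
- by move=> _; apply: generated_vac.
- by move=> /IH; apply: sl2_mode.
- by move=> /andP[/IHu Hu /IHv Hv]; apply: (subspD subspace_sl2).
- by move=> /IH; apply: (subspZ subspace_sl2).
Qed.

Lemma outer_sl2 v : sl2_subalgebra v -> outer v = 0.
Proof.
apply: (@generated_by_sub _ _ _ [set v | outer v = 0]) => [|_ [a _ <-]]; last exact: outer_even.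
split=> [||u n w /= Hu Hw]; last by rewrite outer_derivation Hu Hw nprod0l nprod0r addr0.
  split; first exact: (linop0 linear_op_outer).
  by move=> c u w /= Hu Hw; rewrite linear_op_outer Hu Hw scaler0 addr0.
exact: outer_vac.
Qed.

Lemma outer_mode u n v : sl2_subalgebra u -> outer (nprod u n v) = nprod u n (outer v).
Proof. by move=> /outer_sl2 u0; rewrite outer_derivation u0 nprod0l add0r. Qed.

Lemma sl2_gen a : sl2_subalgebra (J (osp12_even a)).
Proof. by apply: sub_generated; exists a. Qed.

Lemma sl2_omega : sl2_subalgebra omega.
Proof. exact: sl2_expr. Qed.

Lemma outer_x : outer (J x) = x'.
Proof.
rewrite /outer omega_0_x /= rmorphN1 rmorph_nat scaleN1r !vs_vacr.
by rewrite opprB addrA addrAC.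
Qed.

Lemma outer_y : outer (J y) = y'.
Proof.
rewrite /outer omega_0_y /= rmorph_nat !vs_vacr.
by rewrite opprD !opprK addrA.
Qed.

Let outer_mode_gen a n v :
  outer (nprod (J (osp12_even a)) n v) = nprod (J (osp12_even a)) n (outer v).
Proof. by apply: outer_mode; apply: sl2_gen. Qed.

Lemma f0_x' : nprod (J f) 0 x' = - y'.
Proof.
rewrite -outer_x -outer_mode_gen.
have -> : nprod (J f) 0 (J x) = - J y.
  by case: hJ => _ /(_ f x 0%N) /= ->; rewrite big_seq1 scaleN1r.
by rewrite (linopN linear_op_outer) outer_y.
Qed.

Lemma f0_y' : nprod (J f) 0 y' = 0.
Proof.
rewrite -outer_y -outer_mode_gen.
by case: hJ => _ /(_ f y 0%N) /= ->; rewrite big_nil (linop0 linear_op_outer).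
Qed.

(** E commutes with the modes of the sl(2) subalgebra, so it carries the formula for x to x': the
    pair x', y' is again a doublet. *)
Lemma omega_0_x' :
  nprod omega 0 x' = nprod (J h) (-1) x' - 2 *: nprod (J e) (-1) y'.
Proof.
rewrite -{1}outer_x -outer_mode ?omega_0_x; last exact: sl2_omega.
rewrite (linopB linear_op_outer) (linopZ linear_op_outer).
by rewrite !outer_mode_gen outer_x outer_y.
Qed.

Lemma omega_0_y' :
  nprod omega 0 y' = - nprod (J h) (-1) y' - 2 *: nprod (J f) (-1) x'.
Proof.
rewrite -{1}outer_y -outer_mode ?omega_0_y; last exact: sl2_omega.
rewrite (linopB linear_op_outer) (linopN linear_op_outer) (linopZ linear_op_outer).
by rewrite !outer_mode_gen outer_x outer_y.
Qed.

Hypothesis casimir0 : eval J casimir_expr = 0.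

(* E x' = 2 x(-1) S, where S = 0 is the Sugawara vector *)
Lemma outer_x' : outer x' = 0.
Proof.
rewrite /outer omega_0_x' -eval_transl opprB.
have := expr_eqP hJ (e1 := transl_expr x'_expr + (2 ** e _[-1] y'_expr - h _[-1] x'_expr))
  (e2 := 2 ** x _[-1] casimir_expr).
rewrite -[eval J (2 ** _)]/(ratr 2 *: nprod (J x) (-1) (eval J casimir_expr)).
rewrite casimir0 nprod0r scaler0.
rewrite -[eval J (_ + _)]/(eval J (transl_expr x'_expr)
  + (ratr 2 *: nprod (J e) (-1) y' + ratr (-1) *: nprod (J h) (-1) x')).
by rewrite rmorphN1 scaleN1r rmorph_nat => ->.
Qed.

Lemma outer_y' : outer y' = 0.
Proof.
rewrite -[y']opprK -f0_x' (linopN linear_op_outer) outer_mode_gen outer_x'.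
by rewrite nprod0r oppr0.
Qed.

End CriticalLevel.

(** * Singular vectors for affine sl(2) and the vectors Z *)

Section SingularVectors.
Local Notation e := (osp12_even sl2_e).
Local Notation f := (osp12_even sl2_f).
Local Notation h := (osp12_even sl2_h).
Local Notation x := osp12_x.
Local Notation y := osp12_y.

Variables (F : numFieldType) (L : vertexSuperalgebra F) (J : osp12 F -> L).
Hypothesis hJ : affine_at_level (- (3 / 2)) J.
Implicit Types (u v w : L).

Local Notation omega := (eval J omega_expr).
Local Notation x' := (eval J x'_expr).
Local Notation y' := (eval J y'_expr).
Local Notation E := (outer J).
Local Notation V0 := (sl2_subalgebra J).

Let hom := affine_homog hJ.
Let linE := linear_op_outer J.

(** A highest weight vector of spin 1 for affine sl(2); f(0) sends it to the weight zero vector of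
    its triplet. *)
Definition singular2 v : Prop :=
  [/\ forall n : nat, nprod (J e) n v = 0, forall n : nat, nprod (J f) n.+1 v = 0,
      forall n : nat, nprod (J h) n.+1 v = 0 & nprod (J h) 0 v = 2 *: v].

Lemma singular2_outer v : singular2 v -> singular2 (E v).
Proof.
have EJ a n w : nprod (J (osp12_even a)) n (E w) = E (nprod (J (osp12_even a)) n w).
  by rewrite (outer_mode hJ) //; apply: sl2_gen.
case=> he hf hh h0; split=> [n|n|n|]; rewrite EJ ?he ?hf ?hh ?(linop0 linE) //.
by rewrite h0 (linopZ linE).
Qed.

(** Of the normally ordered sum only b(n) a(0) v remains, because all other terms apply a positive
    mode to [v] first. *)
Lemma normal_product_low a b n v : homog false a -> homog false b ->
  (forall j : nat, nprod a j.+1 v = 0) -> (forall j : nat, nprod b j.+1 v = 0) ->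
  nprod (nprod a (-1) b) n.+1%:Z v = nprod b n%:Z (nprod a 0 v).
Proof.
move=> ea eb av bv; have [N H] := normal_product_formula v n.+1%:Z ea eb.
rewrite (H N.+1) // => {H}.
have b0 (j : nat) : nprod b (n.+1%:Z + j%:Z) v = 0 by rewrite -PoszD addSn.
under eq_bigr do rewrite b0 nprod0r add0r scale1r.
rewrite big_ord_recl big1 => [|j _]; last by rewrite av nprod0r.
by rewrite addr0; congr (nprod _ _ _); rewrite /=; lia.
Qed.

Section WeightZero.
Variables (v : L) (hv : singular2 v).
Local Notation Z := (nprod (J f) 0 v).

Lemma singular2_e n : nprod (J e) n%:Z Z = if n == 0%N then 2 *: v else 0.
Proof.
case: hv => he hf hh h0; rewrite (affine_commutator hJ) /= big_seq1 he nprod0r scaler0 add0r.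
rewrite scale1r addr0; case: n => [|n]; first by rewrite eqxx mul0r scale0r addr0 h0.
by rewrite hh scale0r addr0.
Qed.

Lemma singular2_f n : nprod (J f) n.+1 Z = 0.
Proof.
case: hv => he hf hh h0; rewrite (affine_commutator hJ) /= big_nil hf nprod0r scaler0.
by rewrite !add0r scale0r.
Qed.

Lemma singular2_h n : nprod (J h) n%:Z Z = 0.
Proof.
case: hv => he hf hh h0; rewrite (affine_commutator hJ) /= big_seq1 /=.
rewrite !addr0 mulr0 mulr0 if_same scale0r addr0 expr0 scale1r.
case: n => [|n]; first by rewrite h0 nprodZr scaleNr subrr.
by rewrite hh hf nprod0r scaler0 addr0.
Qed.

Lemma singular2_parafermion : parafermion (J h) Z.
Proof. exact: singular2_h. Qed.

(** The terms in [h] act by zero on Z. For the weight, f(0)e(0)Z and e(0)f(0)Z each give 2 Z, in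
    accordance with j(j + 1)/(k + 2) = 4 for j = 1. *)
Lemma singular2_primary :
  primary (omega_parafermion (- (3 / 2)) (J e) (J f) (J h)) 4 Z.
Proof.
have eS n : nprod (J e) n.+1 Z = 0 by rewrite singular2_e.
have hS n : nprod (J h) n.+1 Z = 0 by rewrite singular2_h.
have Zh0 : nprod (J h) 0 Z = 0 := singular2_h 0.
have Ze0 : nprod (J e) 0 Z = 2 *: v := singular2_e 0.
have ev a := hom (osp12_even a).
have hh n : nprod (nprod (J h) (-1) (J h)) n.+1 Z = 0.
  by rewrite (normal_product_low _ (ev sl2_h) (ev sl2_h)) // Zh0 nprod0r.
split=> [|[//|n] _]; rewrite /omega_parafermion nprodBl nprodZl hh scaler0 subr0;
  rewrite /omega_sug !nprodDl nprodZl hh scaler0 addr0.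
- rewrite (normal_product_low 0 (ev sl2_e) (ev sl2_f)) //; last exact: singular2_f.
  rewrite (normal_product_low 0 (ev sl2_f) (ev sl2_e)) //; last exact: singular2_f.
  rewrite Ze0 nprodZr.
  have -> : nprod (J e) 0 (nprod (J f) 0 Z) = 2 *: Z.
    rewrite (affine_commutator hJ) /= big_seq1 /= Zh0 scaler0 addr0.
    by rewrite mul0r scale0r addr0 scale1r Ze0 nprodZr.
  by rewrite -scalerDl -natrD.
- rewrite (normal_product_low n.+1 (ev sl2_e) (ev sl2_f)) //; last exact: singular2_f.
  rewrite (normal_product_low n.+1 (ev sl2_f) (ev sl2_e)) //; last exact: singular2_f.
  case: hv => he hf hh' h0.
  rewrite Ze0 nprodZr hf scaler0 add0r.
  rewrite (affine_commutator hJ) /= big_seq1 /= eS nprod0r scaler0 addr0 singular2_h.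
  by rewrite scaler0 addr0 scale0r addr0.
Qed.

End WeightZero.

Hypothesis casimir0 : eval J casimir_expr = 0.

Let casimir_mode c a n : eval J (c ** a _[n] casimir_expr) = 0.
Proof.
rewrite -[LHS]/(ratr c *: nprod (J a) n (eval J casimir_expr)).
by rewrite casimir0 nprod0r scaler0.
Qed.

Let casimir_scale c : eval J (c ** casimir_expr) = 0.
Proof. by rewrite -[LHS]/(ratr c *: eval J casimir_expr) casimir0 scaler0. Qed.

Let x'_high a (n : nat) : (2 < n)%N -> nprod (J a) n x' = 0.
Proof. by move=> n2; apply: (eval_high_mode hJ (d := 2) (p := true)); [vm_compute|lia]. Qed.

Lemma x_0_x' : nprod (J x) 0 x' = eval J ((-1) ** e _[-2] 1).
Proof. by apply: (expr_eqP hJ (e1 := x _[0] x'_expr)); vm_compute. Qed.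

Lemma x_1_x' : nprod (J x) 1 x' = eval J ((-2) ** e _[-1] 1).
Proof. by apply: (expr_eqP hJ (e1 := x _[1] x'_expr)); vm_compute. Qed.

Lemma x_2_x' : nprod (J x) 2 x' = 0.
Proof. by rewrite -(eval0 J); apply: (expr_eqP hJ (e1 := x _[2] x'_expr)); vm_compute. Qed.

(** Normal ordering leaves a term 3 x(-1)y, which the relation -3 S = 0 trades for terms in the even
    currents. *)
Lemma y_0_x' : nprod (J y) 0 x' = eval J (omega_expr - (1 / 2) ** h _[-2] 1).
Proof.
by apply: (expr_eq_mod hJ (u := y _[0] x'_expr) (casimir_scale (-3))); vm_compute.
Qed.

Lemma y_1_x' : nprod (J y) 1 x' = eval J ((-1) ** h _[-1] 1).
Proof. by apply: (expr_eqP hJ (e1 := y _[1] x'_expr)); vm_compute. Qed.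

Lemma y_2_x' : nprod (J y) 2 x' = eval J ((-3) ** 1).
Proof. by apply: (expr_eqP hJ (e1 := y _[2] x'_expr)); vm_compute. Qed.

Lemma h_0_x' : nprod (J h) 0 x' = x'.
Proof. by apply: (expr_eqP hJ (e1 := h _[0] x'_expr)); vm_compute. Qed.

Lemma x_x'_sl2 (n : nat) : V0 (nprod (J x) n x').
Proof.
case: n => [|[|[|n]]].
- by rewrite x_0_x'; apply: sl2_expr.
- by rewrite x_1_x'; apply: sl2_expr.
- by rewrite x_2_x'; apply: (subsp0 (subspace_sl2 J)).
- by rewrite x'_high //; apply: (subsp0 (subspace_sl2 J)).
Qed.

Lemma y_x'_sl2 (n : nat) : V0 (nprod (J y) n x').
Proof.
case: n => [|[|[|n]]].
- by rewrite y_0_x'; apply: sl2_expr.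
- by rewrite y_1_x'; apply: sl2_expr.
- by rewrite y_2_x'; apply: sl2_expr.
- by rewrite x'_high //; apply: (subsp0 (subspace_sl2 J)).
Qed.

(** The only odd term is 2 e(-1) x(-1) y, removed by -2 e(-1) S = 0. Having this product in [V0]
    makes x(-2)x equal to s modulo [V0] and lets skew-symmetry reach the index -2. *)
Lemma x_N1_x'_sl2 : V0 (nprod (J x) (-1) x').
Proof.
rewrite -[nprod _ _ _]/(eval J (x _[-1] x'_expr)).
rewrite (expr_eq_mod hJ (v := 2 ** e _[-3] 1 - h _[-1] e _[-2] 1
  + 2 ** e _[-1] (omega_expr + (1 / 2) ** h _[-2] 1)) (casimir_mode (-2) e (-1))).
  exact: sl2_expr.
by vm_compute.
Qed.

Local Notation s := (eval J singular_expr).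

Lemma singular_homog : homog false s.
Proof. by apply: (eval_homog hJ (d := 3)); vm_compute. Qed.

Lemma singular_singular2 : singular2 s.
Proof.
have hi a (n : nat) : (3 < n)%N -> nprod (J a) n s = 0.
  by move=> n2; apply: (eval_high_mode hJ (d := 3) (p := false)); [vm_compute|lia].
have lo a n : expr_eq (a _[n] singular_expr) zero_expr -> nprod (J a) n s = 0.
  by move=> /(expr_eqP hJ); rewrite eval0.
split=> [n|n|n|].
- by case: n => [|[|[|[|n]]]]; [apply: lo; vm_compute..|apply: hi].
(* The mode f(1) sends s to 2 S, so its vanishing rests on the relation S = 0. *)
- case: n => [|[|[|n]]]; [|apply: lo; vm_compute; reflexivity..|exact: hi].
  rewrite -[RHS](eval0 J).
  by apply: (expr_eq_mod hJ (u := f _[1] singular_expr) (casimir_scale 2)); vm_compute.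
- by case: n => [|[|[|n]]]; [apply: lo; vm_compute..|apply: hi].
- have := expr_eqP hJ (e1 := h _[0] singular_expr) (e2 := 2 ** singular_expr).
  rewrite -[eval J (_ _[0] _)]/(nprod (J h) 0 s).
  by rewrite -[eval J (_ ** _)]/(ratr 2 *: s) rmorph_nat => ->.
Qed.

Lemma x'_x n : nprod x' n (J x) = E (nprod (J x) n (J x)) - nprod (J x) n x'.
Proof. by rewrite (outer_derivation hJ) (outer_x hJ) addrK. Qed.

(** x(-1)x is half of an anticommutator, namely e(-2) 1, which E kills. *)
Lemma x'_N1_x : nprod x' (-1) (J x) = - nprod (J x) (-1) x'.
Proof.
rewrite x'_x; have -> : nprod (J x) (-1) (J x) = eval J (e _[-2] 1).
  rewrite -[in LHS](vs_vacr (J x)); rewrite -[RHS]/(eval J (e _[-2] 1)) vs_vacr.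
  rewrite -[X in nprod _ _ X = _]vs_vacr -[LHS]/(eval J (x _[-1] x _[-1] 1)).
  by apply: (expr_eqP hJ); vm_compute.
by rewrite (outer_sl2 hJ) ?sub0r //; apply: sl2_expr.
Qed.

(** Since E x' = 0, applying E to [x'_N1_x] gives x'(-1)x' on the left and its negative on the
    right. *)
Lemma x'_N1_x' : nprod x' (-1) x' = 0.
Proof.
have := congr1 E x'_N1_x; rewrite (linopN linE) !(outer_derivation hJ).
rewrite (outer_x hJ) (outer_x' hJ casimir0) nprod0l nprod0r addr0 add0r => /eqP.
by rewrite -subr_eq0 opprK -mulr2n -scaler_nat scaler_eq0 pnatr_eq0 => /eqP.
Qed.

Lemma singularE : s = nprod (J x) (-2) (J x) + nprod (J x) (-1) x'.
Proof.
rewrite -[LHS]/(nprod (J x) (-2) (nprod (J x) (-1) vac) + nprod (J x) (-1) x').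
by rewrite vs_vacr.
Qed.

Lemma outer_singular : E s = nprod x' (-2) (J x) + nprod (J x) (-2) x'.
Proof.
rewrite singularE (linopD linE) !(outer_derivation hJ).
by rewrite (outer_x hJ) (outer_x' hJ casimir0) x'_N1_x' nprod0r !addr0.
Qed.

Lemma outer2_singular : E (E s) = 2 *: nprod x' (-2) x'.
Proof.
rewrite outer_singular (linopD linE) !(outer_derivation hJ).
rewrite (outer_x hJ) (outer_x' hJ casimir0) nprod0l nprod0r addr0 add0r.
by rewrite -mulr2n scaler_nat.
Qed.

Lemma outer3_singular : E (E (E s)) = 0.
Proof.
rewrite outer2_singular (linopZ linE) (outer_derivation hJ) (outer_x' hJ casimir0).
by rewrite nprod0l nprod0r addr0 scaler0.
Qed.

Lemma omega_1_x' : nprod omega 1 x' = (3 / 2) *: x'.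
Proof.
rewrite -(outer_x hJ) -(outer_mode hJ) ?(omega_1_x hJ) ?(linopZ linE) //.
exact: sl2_omega.
Qed.

(** The commutator formula gives the sum of binom(3, j) (y(j)x')_(1 - j) x' for j = 0, 1, 2. The
    three terms are (3/2 + 1/2) x', -3 x' and -9 x'. *)
Lemma y_3_x'_N2_x' : nprod (J y) 3 (nprod x' (-2) x') = - 10 *: x'.
Proof.
have x'_odd := x'_odd hJ.
rewrite (@super_commutator_trunc F L 3 _ _ _ _ x' 3 (-2) (hom y) x'_odd); last first.
  by move=> j j3; apply: x'_high.
rewrite x'_high // nprod0r scaler0 add0r !big_ord_recl big_ord0.
rewrite -[nprod (nprod _ ord0 _) _ _]/(nprod (nprod (J y) 0 x') 1 x').
rewrite -[nprod (nprod _ (lift ord0 ord0) _) _ _]/(nprod (nprod (J y) 1 x') 0 x').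
rewrite -[nprod (nprod _ (lift ord0 (lift _ _)) _) _ _]/(nprod (nprod (J y) 2 x') (-1) x').
rewrite y_0_x' y_1_x' y_2_x' eval_sub.
rewrite -[eval J (_ ** h _[-2] 1)]/(ratr (1 / 2) *: transl (J h)).
rewrite -[eval J (_ ** h _[-1] 1)]/(ratr (-1) *: nprod (J h) (-1) vac).
rewrite -[eval J (_ ** 1)]/(ratr (-3) *: (vac : L)).
rewrite vs_vacr nprodBl !nprodZl transl_mode subrr vs_vacN1 h_0_x' omega_1_x'.
rewrite !binzS binz0 !scalerA -scalerBl scalerA addr0 -!scalerDl; congr (_ *: _).
rewrite fmorph_div !rmorphN !rmorph1 !rmorph_nat /= /bump /=.
by field.
Qed.

Lemma outer2_singular_neq0 : (vac : L) <> 0 -> E (E s) != 0.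
Proof.
move=> vac0; apply/eqP => E2; case: vac0.
have : nprod (J y) 2 (nprod (J y) 3 (E (E s))) = 0 by rewrite E2 !nprod0r.
rewrite outer2_singular !nprodZr y_3_x'_N2_x' !nprodZr y_2_x'.
rewrite -[eval J _]/(ratr (-3) *: (vac : L)) rmorphN rmorph_nat !scalerA => /eqP.
rewrite scaler_eq0 => /orP[|/eqP //].
by rewrite !mulf_eq0 !oppr_eq0 !pnatr_eq0.
Qed.

Definition Zvec (i : 'I_3) : L := nprod (J f) 0 (iter i E s).

Lemma singular2_iter i : singular2 (iter i E s).
Proof. by elim: i => [|i IH]; [exact: singular_singular2|exact: singular2_outer]. Qed.

(** e(0) undoes f(0) up to the factor 2, which reduces the claim to the Jordan chain s, E s, E^2 s
    of E. *)
Lemma Zvec_independent : (vac : L) <> 0 -> linearly_independent Zvec.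
Proof.
move=> /outer2_singular_neq0/negP/negP E2 c; rewrite /Zvec.
move=> /(congr1 (nprod (J e) 0)); rewrite nprod0r nprod_sumr.
under eq_bigr do rewrite nprodZr (singular2_e (singular2_iter _) 0) /= scalerA mulrC -scalerA.
rewrite -scaler_sumr => /eqP; rewrite scaler_eq0 pnatr_eq0 /= => /eqP.
rewrite !big_ord_recl big_ord0 addr0.
move=> /(nilpotent_independent linE E2 outer3_singular)[c00 c10 c20].
move=> i; case: (unliftP ord0 i) => [j ->|->] //; case: (unliftP ord0 j) => [k ->|->] //.
by rewrite (_ : k = ord0) // ord1.
Qed.

Lemma Zvec_even i : homog false (Zvec i).
Proof.
apply: (vs_homog_nprod 0 (hom f)); elim: (nat_of_ord i) => [|n IH] /=.
  exact: singular_homog.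
exact: outer_homog.
Qed.

Lemma Zvec_parafermion i : parafermion (J h) (Zvec i).
Proof. exact/singular2_parafermion/singular2_iter. Qed.

Lemma Zvec_primary i : primary (omega_parafermion (- (3 / 2)) (J e) (J f) (J h)) 4 (Zvec i).
Proof. exact/singular2_primary/singular2_iter. Qed.

End SingularVectors.

(** * Products of the odd currents *)

Section Recursion.
Local Notation e := (osp12_even sl2_e).
Local Notation f := (osp12_even sl2_f).
Local Notation h := (osp12_even sl2_h).
Local Notation x := osp12_x.
Local Notation y := osp12_y.

Variables (F : numFieldType) (L : vertexSuperalgebra F) (J : osp12 F -> L).
Hypothesis hJ : affine_at_level (- (3 / 2)) J.
Variable W : set L.
Hypotheses (hW : subspace W) (WJ : forall a, preserves W (J (osp12_even a))).
Implicit Types (a b c : L) (n m : int).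

Let hom := affine_homog hJ.

(** In the normally ordered expansion the terms with [a] acting first involve only the products
    [a_(m) c] with [m > n], already in [W]; of the others only the zero mode of [g] survives on
    [c]. *)
Let normal_product_mod g a c n : homog true a ->
  (forall j : nat, nprod (J (osp12_even g)) j.+1 c = 0) ->
  (forall m, n < m -> W (nprod a m c)) ->
  W (nprod (nprod (J (osp12_even g)) (-1) a) (n + 1) c
     - nprod a n (nprod (J (osp12_even g)) 0 c)).
Proof.
move=> oa gc IH; have [N H] := normal_product_formula c (n + 1) (hom (osp12_even g)) oa.
rewrite (H N.+1) // => {H}; rewrite big_split /= -addrA; apply: (subspD hW).
  by apply: (subsp_sum hW) => j _; apply/WJ/IH; lia.
rewrite big_ord_recl big1 => [|j _]; last by rewrite gc nprod0r scaler0.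
rewrite addr0 expr0 scale1r (_ : n + 1 - 1 - _ = n) ?subrr; last by rewrite /=; lia.
exact: (subsp0 hW).
Qed.

Section Doublets.
Variables (a a1 a' a1' b b1 : L).
Hypotheses (oa : homog true a) (oa1 : homog true a1).
Hypothesis transl_a :
  transl a = nprod (J h) (-1) a - 2 *: nprod (J e) (-1) a1 + a'.
Hypothesis transl_a1 :
  transl a1 = - nprod (J h) (-1) a1 - 2 *: nprod (J f) (-1) a + a1'.
Hypotheses (f_a : nprod (J f) 0 a = - a1) (f_a1 : nprod (J f) 0 a1 = 0).
Hypotheses (pos_b : forall g (j : nat), nprod (J (osp12_even g)) j.+1 b = 0)
  (pos_b1 : forall g (j : nat), nprod (J (osp12_even g)) j.+1 b1 = 0).
Hypotheses (h_b : nprod (J h) 0 b = b) (h_b1 : nprod (J h) 0 b1 = - b1)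
  (e_b : nprod (J e) 0 b = 0) (e_b1 : nprod (J e) 0 b1 = - b)
  (f_b : nprod (J f) 0 b = - b1) (f_b1 : nprod (J f) 0 b1 = 0).

Definition doublet_products n : Prop :=
  [/\ W (nprod a n b), W (nprod a n b1), W (nprod a1 n b) & W (nprod a1 n b1)].

Hypothesis Wa' : forall n,
  [/\ W (nprod a' n b), W (nprod a' n b1), W (nprod a1' n b) & W (nprod a1' n b1)].

(* (D a)(n+1) = - (n+1) a(n), where D a = h(-1) a - 2 e(-1) a1 + a' *)
Let rec_a c n : (forall g (j : nat), nprod (J (osp12_even g)) j.+1 c = 0) ->
  W (nprod a' (n + 1) c) ->
  (forall m, n < m -> W (nprod a m c) /\ W (nprod a1 m c)) ->
  W ((n + 1)%:~R *: nprod a n c + nprod a n (nprod (J h) 0 c)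
     - 2 *: nprod a1 n (nprod (J e) 0 c)).
Proof.
move=> pc Wc IH.
have Wh := @normal_product_mod sl2_h _ _ n oa (pc sl2_h) (fun m nm => proj1 (IH m nm)).
have We := @normal_product_mod sl2_e _ _ n oa1 (pc sl2_e) (fun m nm => proj2 (IH m nm)).
have := transl_mode a (n + 1) c.
rewrite transl_a addrK nprodDl nprodBl nprodZl => E.
have -> : (n + 1)%:~R *: nprod a n c = - (nprod (nprod (J h) (-1) a) (n + 1) c -
    2 *: nprod (nprod (J e) (-1) a1) (n + 1) c + nprod a' (n + 1) c).
  by rewrite E scaleNr opprK.
have := subspD hW (subspN hW Wh) (subspZ hW 2 We).
move=> /(subspB hW)/(_ Wc); congr W.
by rewrite scalerBr !opprD !opprK !addrA [RHS](ACl (1*4*2*5*3)).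
Qed.

Let rec_a1 c n : (forall g (j : nat), nprod (J (osp12_even g)) j.+1 c = 0) ->
  W (nprod a1' (n + 1) c) ->
  (forall m, n < m -> W (nprod a m c) /\ W (nprod a1 m c)) ->
  W ((n + 1)%:~R *: nprod a1 n c - nprod a1 n (nprod (J h) 0 c)
     - 2 *: nprod a n (nprod (J f) 0 c)).
Proof.
move=> pc Wc IH.
have Wh := @normal_product_mod sl2_h _ _ n oa1 (pc sl2_h) (fun m nm => proj2 (IH m nm)).
have Wf := @normal_product_mod sl2_f _ _ n oa (pc sl2_f) (fun m nm => proj1 (IH m nm)).
have := transl_mode a1 (n + 1) c.
rewrite transl_a1 addrK nprodDl nprodBl nprodNl nprodZl => E.
have -> : (n + 1)%:~R *: nprod a1 n c = - (- nprod (nprod (J h) (-1) a1) (n + 1) c -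
    2 *: nprod (nprod (J f) (-1) a) (n + 1) c + nprod a1' (n + 1) c).
  by rewrite E scaleNr opprK.
have := subspD hW Wh (subspZ hW 2 Wf).
move=> /(subspB hW)/(_ Wc); congr W.
by rewrite scalerBr !opprD !opprK !addrA [RHS](ACl (1*4*2*5*3)).
Qed.

(** A symmetric 2 by 2 system with diagonal [k] and off-diagonal 2; its determinant vanishes exactly
    at k = 2 and k = -2. *)
Let solve (k : F) u v : k * k - 4 != 0 -> W (k *: u + 2 *: v) -> W (k *: v + 2 *: u) -> W u.
Proof.
move=> k0 H1 H2; have := subspB hW (subspZ hW k H1) (subspZ hW 2 H2).
rewrite !scalerDr !scalerA [2 * k]mulrC opprD addrA addrK -scalerBl -natrM.
by move/(subspZ hW (k * k - 4)^-1); rewrite scalerA mulVf // scale1r.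
Qed.

Let cancel (k : F) u : k != 0 -> W (k *: u) -> W u.
Proof. by move=> k0 /(subspZ hW k^-1); rewrite scalerA mulVf // scale1r. Qed.

(** Here (a, a1) and (b, b1) are doublets and (a', a1') is the inhomogeneous term of the
    Knizhnik-Zamolodchikov equation. Modulo [W] and the products of larger index, the extremal
    products satisfy (n + 2) u = 0, and the mixed pair satisfies the system of [solve] with k = n.
    Both degenerate at n = -2, where one extremal product has to be given. *)
Lemma doublet_recursion : (forall n : nat, doublet_products n%:Z) ->
  W (nprod a (-2) b) -> forall n, doublet_products n.
Proof.
move=> P0 W2 n.
suff H (k : nat) : forall n, - k%:Z <= n -> doublet_products n.
  by apply: (H `|n|%N); lia.
elim: k {n} => [|k IH] n nk; first by case: n nk => // n _; apply: P0.
have [|nk'] := boolP (- k%:Z <= n); first exact: IH.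
have nE : n = - k.+1%:Z by lia.
have [IHb IHb1] : (forall m, n < m -> W (nprod a m b) /\ W (nprod a1 m b)) /\
    (forall m, n < m -> W (nprod a m b1) /\ W (nprod a1 m b1)).
  by split=> m nm; case: (IH m); rewrite ?nE; try lia; split.
have [w1 w2 w3 w4] := Wa' (n + 1).
have Hab := rec_a pos_b w1 IHb; have Ha1b := rec_a1 pos_b w3 IHb.
have Hab1 := rec_a pos_b1 w2 IHb1; have Ha1b1 := rec_a1 pos_b1 w4 IHb1.
rewrite h_b e_b nprod0r scaler0 subr0 -[X in _ + X]scale1r -scalerDl in Hab.
rewrite h_b f_b nprodNr scalerN opprK -[X in _ - X + _]scale1r -scalerBl in Ha1b.
rewrite h_b1 e_b1 !nprodNr scalerN opprK -[X in _ - X + _]scale1r -scalerBl in Hab1.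
rewrite h_b1 f_b1 nprodNr nprod0r scaler0 subr0 opprK -[X in _ + X]scale1r -scalerDl in Ha1b1.
rewrite intrD addrK in Ha1b Hab1; rewrite intrD -addrA in Hab Ha1b1.
have nR : n%:~R = - k.+1%:R :> F by rewrite nE mulrNz.
rewrite {}nR in Hab Ha1b Hab1 Ha1b1.
have [k1|k1] := eqVneq k 1%N; last first.
  have k2 : - k.+1%:R + (1 + 1) != 0 :> F.
    by rewrite addrC subr_eq0 -(natrD _ 1 1) eqr_nat; lia.
  have k4 : - k.+1%:R * - k.+1%:R - 4 != 0 :> F.
    rewrite mulrNN -natrM subr_eq0 eqr_nat; apply/eqP => E; case/eqP: k1; nia.
  split; [exact: cancel Hab|exact: solve Hab1 Ha1b|exact: solve Ha1b Hab1|exact: cancel Ha1b1].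
have {}nE : n = -2 by rewrite nE k1.
rewrite {}k1 {}nE {IH IHb IHb1 w1 w2 w3 w4 Hab Ha1b1} in Ha1b Hab1 *.
have der := @even_mode0_derivation F L (J f) _ _ _ (hom f).
(* At n = -2 the mixed equation only controls the difference of a1(-2)b and a(-2)b1; f(0) applied to
   the given product controls their sum. *)
have := WJ sl2_f 0 W2; rewrite der f_a f_b nprodNl nprodNr => Hs.
have W3 : W (nprod a1 (-2) b).
  apply: (@cancel 4); first by rewrite pnatr_eq0.
  have := subspB hW Hab1 (subspZ hW 2 Hs); congr W.
  rewrite -opprD scalerN opprK scalerDr addrA [LHS](ACl (1*4*(2*3))).
  by rewrite scaleNr /= addNr add0r -scalerDl -natrD.
have W4 : W (nprod a (-2) b1).
  by have := subspN hW (subspD hW Hs W3); rewrite addrAC addNr add0r opprK.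
split=> //; have := WJ sl2_f 0 W3; rewrite der f_a1 f_b nprod0l add0r nprodNr.
by move/(subspN hW); rewrite opprK.
Qed.

End Doublets.
End Recursion.

(** * The recursion for x', y' and then for x, y *)

Section Products.
Local Notation e := (osp12_even sl2_e).
Local Notation f := (osp12_even sl2_f).
Local Notation h := (osp12_even sl2_h).
Local Notation x := osp12_x.
Local Notation y := osp12_y.

Variables (F : numFieldType) (L : vertexSuperalgebra F) (J : osp12 F -> L).
Hypothesis hJ : affine_at_level (- (3 / 2)) J.
Hypothesis casimir0 : eval J casimir_expr = 0.
Implicit Types (u v w : L).

Local Notation x' := (eval J x'_expr).
Local Notation y' := (eval J y'_expr).
Local Notation E := (outer J).
Local Notation V0 := (sl2_subalgebra J).
Local Notation s := (eval J singular_expr).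

Let hom := affine_homog hJ.

Definition sl2_module : set L := sums
  [set v | V0 v \/ exists a n i, V0 a /\ v = nprod a n (Zvec J i)].

Local Notation W := sl2_module.

Lemma subspace_sl2_module : subspace W.
Proof.
apply: subspace_sums => c v [Vv|[a [n [i [Va ->]]]]].
  by left; apply: (subspZ (subspace_sl2 J)).
right; exists (c *: a), n, i; split; first exact: (subspZ (subspace_sl2 J)).
by rewrite nprodZl.
Qed.

Let hW := subspace_sl2_module.

Lemma sl2_sub_module v : V0 v -> W v.
Proof. by move=> Vv; apply: sums1; left. Qed.

Lemma sl2_module_Zvec a n i : V0 a -> W (nprod a n (Zvec J i)).
Proof. by move=> Va; apply: sums1; right; exists a, n, i. Qed.

(** By associativity g(n) a(m) Z_i is a combination of products (g(i) a)_(j) Z_i, so a single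
    product with each Z_i suffices in the definition of the module. *)
Lemma sl2_module_mode g : preserves W (J (osp12_even g)).
Proof.
move=> n v [r -> Hr]; rewrite nprod_sumr big_seq.
apply: (subsp_sum hW) => u /Hr[Vu|[a [m [i [Va ->]]]]].
  by apply: sl2_sub_module; apply: sl2_mode.
apply: (associativity_span (M := W) (p := false) (q := false)).
- exact: hW.
- exact: (hom (osp12_even g)).
- exact: (sl2_even hJ Va).
- by move=> j l; apply: sl2_module_Zvec; apply: sl2_mode.
Qed.

Lemma odd_products (a b : osp12 F) (n : nat) : lie_odd a -> lie_odd b ->
  V0 (nprod (J a) n (J b)).
Proof.
have V0s := subspace_sl2 J.
case: hJ => _ rel oa ob; rewrite rel; case: n => [|[|n]].
- by case: a b oa ob => [?| |] [?| |] //= _ _; rewrite big_seq1;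
    apply: (subspZ V0s); apply: sl2_gen.
- by apply: (subspZ V0s); apply: generated_vac.
- exact: (subsp0 V0s).
Qed.

(** e(0) Z_i is twice the i-th iterate of E on s. *)
Lemma singular_module i : (i < 3)%N -> W (iter i E s).
Proof.
move=> i3; have := sl2_module_Zvec 0 (Ordinal i3) (@sl2_gen F L J sl2_e).
rewrite /Zvec /= (singular2_e hJ (singular2_iter hJ casimir0 i) 0) /=.
by move/(subspZ hW 2^-1); rewrite scalerA mulVf ?scale1r // pnatr_eq0.
Qed.

Lemma even_x g (j : nat) : nprod (J (osp12_even g)) j.+1 (J x) = 0.
Proof. by case: hJ => _ ->; case: j => //; case: g => //=; rewrite mulr0 scale0r. Qed.

Lemma even_y g (j : nat) : nprod (J (osp12_even g)) j.+1 (J y) = 0.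
Proof. by case: hJ => _ ->; case: j => //; case: g => //=; rewrite mulr0 scale0r. Qed.

Let even_odd_0 g a : nprod (J (osp12_even g)) 0 (J a) =
  \sum_(t <- osp12_br F (osp12_even g) a) t.1 *: J t.2.
Proof. by case: hJ => _ /(_ _ _ 0%N). Qed.

Let h_x : nprod (J h) 0 (J x) = J x.
Proof. by rewrite even_odd_0 big_seq1 scale1r. Qed.
Let h_y : nprod (J h) 0 (J y) = - J y.
Proof. by rewrite even_odd_0 big_seq1 scaleN1r. Qed.
Let e_x : nprod (J e) 0 (J x) = 0.
Proof. by rewrite even_odd_0 big_nil. Qed.
Let e_y : nprod (J e) 0 (J y) = - J x.
Proof. by rewrite even_odd_0 big_seq1 scaleN1r. Qed.
Let f_x : nprod (J f) 0 (J x) = - J y.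
Proof. by rewrite even_odd_0 big_seq1 scaleN1r. Qed.
Let f_y : nprod (J f) 0 (J y) = 0.
Proof. by rewrite even_odd_0 big_nil. Qed.

Let f0_der n u v : nprod (J f) 0 (nprod u n v) =
  nprod (nprod (J f) 0 u) n v + nprod u n (nprod (J f) 0 v).
Proof. exact: even_mode0_derivation (hom f). Qed.

Lemma x_y'_sl2 (n : nat) : V0 (nprod (J x) n y').
Proof.
have f0 := f0_der n (J x) x'; rewrite f_x (f0_x' hJ) nprodNl nprodNr in f0.
have -> : nprod (J x) n y' = - (nprod (J f) 0 (nprod (J x) n x') + nprod (J y) n x').
  by rewrite f0 addrAC addNr add0r opprK.
apply: (subspN (subspace_sl2 J)); apply: (subspD (subspace_sl2 J)).
  by apply: sl2_mode; apply: (x_x'_sl2 hJ).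
exact: (y_x'_sl2 hJ casimir0).
Qed.

Lemma y_y'_sl2 (n : nat) : V0 (nprod (J y) n y').
Proof.
have f0 := f0_der n (J y) x'; rewrite f_y (f0_x' hJ) nprod0l add0r nprodNr in f0.
rewrite -[nprod _ _ y']opprK -f0.
by apply: (subspN (subspace_sl2 J)); apply: sl2_mode; apply: (y_x'_sl2 hJ casimir0).
Qed.

(** For nonnegative [n] the product of two odd currents lies in [V0], so E kills it and the Leibniz
    rule moves E across. *)
Let outer_products a b (n : nat) : lie_odd (a : osp12 F) -> lie_odd (b : osp12 F) ->
  nprod (E (J a)) n (J b) = - nprod (J a) n (E (J b)).
Proof.
move=> oa ob; apply/eqP; rewrite -subr_eq0 opprK -(outer_derivation hJ).
by rewrite (outer_sl2 hJ) //; apply: odd_products.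
Qed.

(** E s is the sum of x'(-2)x and x(-2)x', while skew-symmetry puts their difference in [V0]; hence
    each of them lies in the module. *)
Lemma x'_N2_x_module : W (nprod x' (-2) (J x)).
Proof.
have x'_odd := x'_odd hJ.
have := skew_symmetry_mod (generated_subalgebra _) (hom x) x'_odd (n := -2) (S := V0).
rewrite expr1 mulrN1 -exprz_inv invrN1 -exprnP sqrrN expr1n scaleN1r => WR.
have {}WR : W (nprod (J x) (-2) x' - nprod x' (-2) (J x)).
  apply: sl2_sub_module; apply: WR => -[n|[|n]] // _; first exact: (x_x'_sl2 hJ).
  exact: (x_N1_x'_sl2 hJ casimir0).
have WE : W (E s) := singular_module (isT : (1 < 3)%N).
have := subspB hW WE WR; rewrite (outer_singular hJ casimir0) opprB addrACA subrr addr0.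
rewrite -mulr2n -scaler_nat => /(subspZ hW 2^-1).
by rewrite scalerA mulVf ?scale1r // pnatr_eq0.
Qed.

(** As E x' = E y' = 0, the recursion for the doublet x', y' is homogeneous. It has to come first,
    since these products are the inhomogeneous term for x, y. *)
Lemma x'_products n : doublet_products W x' y' (J x) (J y) n.
Proof.
apply: (doublet_recursion hJ hW sl2_module_mode (a' := 0) (a1' := 0)).
- exact: x'_odd.
- exact: y'_odd.
- have := outer_x' hJ casimir0; rewrite /outer (omega_0_x' hJ) addr0 => /eqP.
  by rewrite subr_eq0 => /eqP.
- have := outer_y' hJ casimir0; rewrite /outer (omega_0_y' hJ) addr0 => /eqP.
  by rewrite subr_eq0 => /eqP.
- exact: f0_x'.
- exact: f0_y'.
- exact: even_x.
- exact: even_y.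
- exact: h_x.
- exact: h_y.
- exact: e_x.
- exact: e_y.
- exact: f_x.
- exact: f_y.
- by move=> m; rewrite !nprod0l; split; apply: (subsp0 hW).
- move=> m; split; rewrite -?(outer_x hJ) -?(outer_y hJ) outer_products //;
    apply: (subspN hW); apply: sl2_sub_module; rewrite ?(outer_x hJ) ?(outer_y hJ).
  + exact: (x_x'_sl2 hJ).
  + exact: x_y'_sl2.
  + exact: (y_x'_sl2 hJ casimir0).
  + exact: y_y'_sl2.
- exact: x'_N2_x_module.
Qed.

(** The missing initial value is x(-2)x = s - x(-1)x'. *)
Lemma odd_products_module n : doublet_products W (J x) (J y) (J x) (J y) n.
Proof.
apply: (doublet_recursion hJ hW sl2_module_mode (a' := x') (a1' := y')).
- exact: (hom x).
- exact: (hom y).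
- by rewrite -(outer_x hJ) /outer (omega_0_x hJ) addrC subrK.
- by rewrite -(outer_y hJ) /outer (omega_0_y hJ) addrC subrK.
- exact: f_x.
- exact: f_y.
- exact: even_x.
- exact: even_y.
- exact: h_x.
- exact: h_y.
- exact: e_x.
- exact: e_y.
- exact: f_x.
- exact: f_y.
- exact: x'_products.
- by move=> m; split; apply: sl2_sub_module; apply: odd_products.
- have Ws : W s := singular_module (isT : (0 < 3)%N).
  have -> : nprod (J x) (-2) (J x) = s - nprod (J x) (-1) x'.
    by rewrite singularE addrK.
  by apply: (subspB hW) => //; apply: sl2_sub_module; apply: (x_N1_x'_sl2 hJ casimir0).
Qed.

End Products.

(** * The part of weight zero *)

Section WeightZeroPart.
Local Notation e := (osp12_even sl2_e).
Local Notation f := (osp12_even sl2_f).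
Local Notation h := (osp12_even sl2_h).
Local Notation x := osp12_x.
Local Notation y := osp12_y.

Variables (F : numFieldType) (L : vertexSuperalgebra F) (J : osp12 F -> L).
Hypothesis hJ : affine_at_level (- (3 / 2)) J.
Implicit Types (u v w : L).

Local Notation V0 := (sl2_subalgebra J).
Local Notation h0 := (nprod (J h) 0).

Let hom := affine_homog hJ.
Let h_even : homog false (J h) := hom h.

Let kappa0 : - (3 / 2) * 2 != 0 :> F.
Proof. by rewrite mulf_eq0 oppr_eq0 mulf_eq0 invr_eq0 !pnatr_eq0. Qed.

Let h_ope (n : nat) : nprod (J h) n%:Z (J h) =
  match n with 1%N => (- (3 / 2) * 2) *: vac | _ => 0 end.
Proof. by case: hJ => _ ->; case: n => [|[|n]] //=; rewrite big_nil. Qed.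

Definition sl2_parafermion : set L := V0 `&` parafermion (J h).

Lemma sl2_parafermion_subalgebra : vertex_subalgebra sl2_parafermion.
Proof.
have [[N0 Nlin] Nv Nn] := parafermion_subalgebra h_even.
have [[G0 Glin] Gv Gn] := generated_subalgebra (range (J \o osp12_even)).
split; first split.
- by split; [exact: G0|exact: N0].
- by move=> c u v [Gu Nu] [Gw Nw]; split; [exact: Glin|exact: Nlin].
- by split; [exact: Gv|exact: Nv].
- by move=> u n v [Gu Nu] [Gw Nw]; split; [exact: Gn|exact: Nn].
Qed.

Definition sl2_current (a : sl2_basis) : L := J (osp12_even a).

Lemma sl2_affine : @affine_at_level F (sl2 F) (- (3 / 2)) L sl2_current.
Proof.
case: hJ => hm rel; split=> [a|a b n]; first exact: (hm (osp12_even a)).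
rewrite /sl2_current rel; case: n => [|[|n]] //.
have -> : @lie_br F (osp12 F) (osp12_even a) (osp12_even b) =
    [seq (t.1, osp12_even t.2) | t <- sl2_br F a b] by case: a; case: b.
exact: big_map.
Qed.

Let sl2_parity (a b : sl2 F) :
  all (fun t => lie_odd t.2 == lie_odd a (+) lie_odd b) (lie_br a b).
Proof. by case: a b => [] []. Qed.

Let sl2_form_parity (a b : sl2 F) : lie_odd a != lie_odd b -> lie_form a b = 0.
Proof. by []. Qed.

Local Notation sl2_pbw := (@pbw F (sl2 F) L sl2_current (@vac_base F L)).

Let sl2_pbw_mode d p v a n : sl2_pbw d p v -> sl2_pbw (d - n) p (nprod (sl2_current a) n v).
Proof.
move=> Pv; apply: (pbw_mode sl2_affine sl2_parity sl2_form_parity _ Pv).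
by move=> d' p' u [_ _ ->] b m; apply: vs_vacr0.
Qed.

Let sl2_pbw_ge0 d p v : sl2_pbw d p v -> 0 <= d \/ v = 0.
Proof. by apply: pbw_degree_ge => d' p' u [->]. Qed.

Let sl2_pbw_sub d p v : sl2_pbw d p v -> V0 v.
Proof.
elim=> {d p v} [d p v [_ _ ->]|a m d p v _ IH|d p|d p c u v _ Vu _ Vv].
- exact: generated_vac.
- exact: sl2_mode.
- exact: (subsp0 (subspace_sl2 J)).
- by case: (subspace_sl2 J) => _; apply.
Qed.

(** A filtration by degree, in the form that [heis_completeness] requires of [K]. *)
Let degree_le (d : int) : set L :=
  sums [set u | exists d' p, d' <= d /\ sl2_pbw d' p u].

Let subspace_degree_le d : subspace (degree_le d).
Proof.
apply: subspace_sums => c v [d' [p [dd Pv]]]; exists d', p; split=> //.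
exact: (subspZ (subspace_pbw _ _ _ _)).
Qed.

Let degree_le_mono d d' v : d <= d' -> degree_le d v -> degree_le d' v.
Proof.
move=> dd; apply: sumsS => u [d1 [p [d1d Pu]]]; exists d1, p; split=> //.
exact: le_trans dd.
Qed.

Let degree_le_mode d v a n : degree_le d v -> degree_le (d - n) (nprod (sl2_current a) n v).
Proof.
apply: (sums_linop (linear_op_mode _ n)) => u [d' [p [dd Pu]]].
by apply: sums1; exists (d' - n), p; split; [lia|apply: sl2_pbw_mode].
Qed.

Let degree_le_neg d v : d < 0 -> degree_le d v -> v = 0.
Proof.
move=> d0 [s -> Hs]; rewrite big_seq big1 // => u /Hs[d' [p [dd Pu]]].
by case: (sl2_pbw_ge0 Pu) => // ?; lia.
Qed.

Let sl2_degree_le v : V0 v -> exists d : nat, degree_le d v.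
Proof.
move: v; pose M := [set v | exists d : nat, degree_le d%:Z v].
apply: (@generated_module F L _ M) => [||_ [a _ <-]|_ [a _ <-] n v [d Kv]].
- split=> [|c u v [d Ku] [d' Kv]]; first by exists 0%N; apply: sums0.
  exists (maxn d d'); have hS := subspace_degree_le (maxn d d')%:Z.
  apply: (proj2 hS); [apply: degree_le_mono Ku|apply: degree_le_mono Kv]; lia.
- by exists 0%N; apply: sums1; exists 0, false; split=> //; apply: pbw_base.
- by exists false; apply: (hom (osp12_even a)).
- exists (d + `|n|)%N; apply: degree_le_mono (degree_le_mode a n Kv); lia.
Qed.

(** Positive modes of [h] lower the filtration [degree_le], which is zero in negative degrees, so
    completeness applies to the weight zero part of [V0]. *)
Lemma sl2_weight0 v : V0 v -> h0 v = 0 -> heis_algebra (J h) sl2_parafermion v.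
Proof.
move=> /sl2_degree_le[d Kv]; apply: (heis_completeness kappa0 h_even h_ope
  sl2_parafermion_subalgebra (A := sl2_parafermion) (K := fun d => degree_le d%:Z)
  _ _ _ _ _ _ _ _ Kv).
- by move=> u [/(sl2_even hJ)].
- by move=> u [].
- by move=> d'; apply: subspace_degree_le.
- move=> d' u Ku Nu; split=> //; apply: (sums_subspace (subspace_sl2 J)) Ku => w.
  by move=> [d1 [p [_ /sl2_pbw_sub]]].
- move=> u Cu; apply: sl2_degree_le; move: u Cu.
  apply: generated_by_sub; first exact: generated_subalgebra.
  by move=> u [->|[]//]; apply: sl2_gen.
- by move=> d1 d2 u dd; apply: degree_le_mono.
- move=> d1 n u nd Ku; rewrite (_ : (d1 - n)%N%:Z = d1%:Z - n%:Z); last by lia.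
  exact: (degree_le_mode sl2_h).
- move=> d1 n u dn Ku; apply: degree_le_neg (degree_le_mode sl2_h n Ku); lia.
Qed.

Let V0_weights v : V0 v -> sums [set u | V0 u /\ exists nu, eigenvector h0 nu u] v.
Proof.
have lin := linear_op_mode (J h) 0.
move: v; apply: generated_module => [||_ [a _ <-]|_ [a _ <-] n v].
- apply: subspace_sums => c v [Vv [nu ev]]; split; first exact: (subspZ (subspace_sl2 J)).
  by exists nu; apply: (subspZ (subspace_eigenvector lin nu)).
- apply: sums1; split; first exact: generated_vac.
  by exists 0; rewrite /eigenvector scale0r (vs_vacr0 _ 0).
- by exists false; apply: (hom (osp12_even a)).
apply: (sums_linop (linear_op_mode _ n)) => u [Vu [nu ev]]; apply: sums1.
split; first exact: sl2_mode.
have [wt hw] : exists wt : F, h0 (J (osp12_even a)) = wt *: J (osp12_even a).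
  case: hJ => _ /(_ h (osp12_even a) 0%N) /= ->.
  by case: a {ev} => /=; rewrite ?big_seq1 ?big_nil;
    [exists 2|exists (-2)|exists 0; rewrite scale0r].
exists (wt + nu); rewrite /eigenvector /= (even_mode0_derivation _ _ _ h_even) hw ev.
by rewrite nprodZl nprodZr scalerDl.
Qed.

Variable A : set L.
Hypothesis hA : vertex_subalgebra A.
Hypotheses (A_sl2 : sl2_parafermion `<=` A) (AN : A `<=` parafermion (J h)).

Local Notation C := (heis_algebra (J h) A).

Lemma heis_algebra_weight0 v : C v -> h0 v = 0.
Proof.
apply: (@generated_by_sub _ _ _ [set v | h0 v = 0]) => [|u [->|/AN/(_ 0%N)//]].
  split; [split|..] => /=.
  - exact: nprod0r.
  - by move=> c u w Hu Hw; rewrite vs_linr Hu Hw scaler0 addr0.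
  - exact: (vs_vacr0 _ 0).
  - move=> u n w Hu Hw.
    by rewrite (even_mode0_derivation _ _ _ h_even) Hu Hw nprod0l nprod0r addr0.
exact: (h_ope 0).
Qed.

Let hC : subspace C. Proof. exact: subspace_generated. Qed.

Let nonzero_weights : set L :=
  sums [set u | exists2 nu, nu != 0 & eigenvector h0 nu u].

(** Expresses, without a projection, that the component of weight zero lies in [C]. *)
Let weight0_split : set L := [set v | exists2 c, C c & nonzero_weights (v - c)].

Let weight0_splitP v : weight0_split v -> h0 v = 0 -> C v.
Proof.
move=> [c Cc Sc] v0; rewrite (@eigenvector_component F L h0 0 v c) //.
- exact: linear_op_mode.
- by rewrite /eigenvector v0 scale0r.
- by rewrite /eigenvector heis_algebra_weight0 // scale0r.
Qed.

Let subspace_weight0_split : subspace weight0_split.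
Proof.
have hS : subspace nonzero_weights.
  apply: subspace_sums => c v [nu nu0 ev]; exists nu => //.
  exact: (subspZ (subspace_eigenvector (linear_op_mode (J h) 0) nu)).
split=> [|c u v [c1 C1 S1] [c2 C2 S2]].
  by exists 0; [exact: (subsp0 hC)|rewrite subr0; exact: (subsp0 hS)].
exists (c *: c1 + c2); first by case: hC => _; apply.
rewrite opprD addrACA -scalerBr; by case: hS => _; apply.
Qed.

Let weight0_split_eigen nu v : eigenvector h0 nu v -> (h0 v = 0 -> C v) -> weight0_split v.
Proof.
move=> ev Cv; have [nu0|nu0] := eqVneq nu 0.
  exists v; first by apply: Cv; rewrite ev nu0 scale0r.
  by rewrite subrr; apply: sums0.
by exists 0; [exact: (subsp0 hC)|rewrite subr0; apply: sums1; exists nu].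
Qed.

Let heis_algebra_mono v : heis_algebra (J h) sl2_parafermion v -> C v.
Proof.
apply: sub_smallest2r; first exact: generated_subalgebra.
by move=> u [->|/A_sl2]; [left|right].
Qed.

Hypothesis A_Z : forall i, A (Zvec J i).

(** Z_i has weight zero, so a(n) Z_i has the weight of [a]. The part of weight zero thus comes from
    those [a] of weight zero, which lie in [C] by [sl2_weight0]. *)
Lemma sl2_module_weight0 v : sl2_module J v -> h0 v = 0 -> C v.
Proof.
have hT := subspace_weight0_split.
move=> Wv; apply: weight0_splitP; apply: (sums_subspace hT) Wv => {v} v.
case=> [/V0_weights|[a [n [i [/V0_weights Va ->]]]]].
  apply: (sums_subspace hT) => u [Vu [nu ev]].
  by apply: (weight0_split_eigen ev) => /(sl2_weight0 Vu)/heis_algebra_mono.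
have hP : subspace [set a | weight0_split (nprod a n (Zvec J i))].
  split=> [|c u w Hu Hw] /=; first by rewrite nprod0l; apply: (subsp0 hT).
  by rewrite vs_linl; case: hT => _; apply.
apply: (sums_subspace hP) Va => u [Vu [nu ev]] /=.
have [nu0|nu0] := eqVneq nu 0.
  exists (nprod u n (Zvec J i)); last by rewrite subrr; apply: sums0.
  apply: generated_nprod; last by apply: sub_generated; right.
  by apply: heis_algebra_mono; apply: (sl2_weight0 Vu); rewrite ev nu0 scale0r.
exists 0; first exact: (subsp0 hC).
rewrite subr0; apply: sums1; exists nu => //.
rewrite /eigenvector (even_mode0_derivation _ _ _ h_even) ev nprodZl.
by rewrite (AN (A_Z i) 0) nprod0r addr0.
Qed.

End WeightZeroPart.

(** * Words in the odd currents and their charge *)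

Section OddWords.
Local Notation e := (osp12_even sl2_e).
Local Notation f := (osp12_even sl2_f).
Local Notation h := (osp12_even sl2_h).
Local Notation x := osp12_x.
Local Notation y := osp12_y.

Variables (F : numFieldType) (k : F).
Variables (L : vertexSuperalgebra F) (J : osp12 F -> L) (C : set L).
Hypothesis hJ : affine_at_level k J.
Hypotheses (hC : vertex_subalgebra C) (Ch : C (J h)).
Implicit Types (u v w : L) (d : nat).

Let hom := affine_homog hJ.
Let Cs : subspace C. Proof. by case: hC. Qed.

(** Words of length [d] in the modes of one odd current [a], applied to [C]. Once opposite charges
    contract into [C], the towers over x and over y span everything, and the length is read off from
    the weight. *)
Inductive tower (a : L) : nat -> set L :=
| tower_base v : C v -> tower a 0 v
| tower_step d (n : int) v : tower a d v -> tower a d.+1 (nprod a n v)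
| tower_zero d : tower a d 0
| tower_lin d c u v : tower a d u -> tower a d v -> tower a d (c *: u + v).

Lemma subspace_tower a d : subspace (tower a d).
Proof. by split=> [|c u v]; [exact: tower_zero|exact: tower_lin]. Qed.

Lemma tower0 a v : tower a 0 v -> C v.
Proof.
move E : 0%N => d H; elim: H E => {d v} [//|//|d _|d c u v _ IHu _ IHv E].
  exact: (subsp0 Cs).
by case: Cs => _; apply; [exact: IHu|exact: IHv].
Qed.

Section OppositeCharges.
Variables (a b : osp12 F) (s : F).
Hypotheses (oa : lie_odd a) (ob : lie_odd b).
Hypotheses (br_ba : lie_br b a = [:: (1, h)]) (br_ha : @lie_br F (osp12 F) h a = [:: (s, a)]).
Hypothesis form_ha : @lie_form F (osp12 F) h a = 0.
Hypothesis Cba : forall n, C (nprod (J b) n (J a)).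

Lemma tower_h d v n : tower (J a) d v -> tower (J a) d (nprod (J h) n v).
Proof.
move=> Tv; elim: Tv n => {d v} [v Cv|d m v Tv IH|d|d c u v _ IHu _ IHv] n.
- by apply: tower_base; case: hC => _ _; apply.
- have hS := subspace_tower (J a) d.+1.
  rewrite (affine_commutator hJ) br_ha form_ha big_seq1 !mulr0 if_same scale0r addr0.
  apply: (subspD hS); apply: (subspZ hS); apply: tower_step => //; exact: IH.
- by rewrite nprod0r; apply: tower_zero.
- by rewrite vs_linr; apply: tower_lin.
Qed.

(** The mode of [b] moves right past the modes of [a]; the brackets are modes of [h], which preserve
    the tower. At the last [a], associativity turns b(n) a(m) c into products of the b(i)a with [c],
    all in [C]. *)
Lemma tower_opposite d v n : tower (J a) d.+1 v -> tower (J a) d (nprod (J b) n v).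
Proof.
move E : d.+1 => d' Tv; elim: Tv d E n => {d' v}
  [v _ d //|d' m v Tv IH d [dd] n|d' d _ n|d' c u v _ IHu _ IHv d E n].
- subst d'.
  case: d => [|d] in Tv IH *.
    apply: tower_base; apply: (associativity_span Cs (hom b) (hom a)) => i j.
    by case: hC => _ _; apply; [exact: Cba|exact: tower0 Tv].
  have hS := subspace_tower (J a) d.+1.
  rewrite (affine_commutator hJ) br_ba big_seq1 oa ob.
  apply: (subspD hS); first apply: (subspD hS).
  + by apply: (subspZ hS); apply: tower_step; apply: IH.
  + by apply: (subspZ hS); apply: tower_h.
  + exact: (subspZ hS).
- by rewrite nprod0r; apply: tower_zero.
- by rewrite vs_linr; apply: tower_lin; [exact: IHu|exact: IHv].
Qed.

Lemma tower_eigenvector d v : (forall c, C c -> nprod (J h) 0 c = 0) ->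
  tower (J a) d v -> eigenvector (nprod (J h) 0) (d%:R * s) v.
Proof.
move=> C0; have lin := linear_op_mode (J h) 0.
elim=> {d v} [v Cv|d m v _ IH|d|d c u v _ IHu _ IHv].
- by rewrite /eigenvector C0 // mul0r scale0r.
- rewrite /eigenvector (even_mode0_derivation _ _ _ (hom h)) IH nprodZr.
  case: hJ => _ /(_ h a 0%N) ->; rewrite br_ha big_seq1 nprodZl -scalerDl.
  by rewrite -natr1 mulrDl mul1r addrC.
- exact: (subsp0 (subspace_eigenvector lin _)).
- exact: (proj2 (subspace_eigenvector lin _)).
Qed.

End OppositeCharges.

Hypothesis gen : generated_by (range J) = setT.
Hypothesis C0 : forall c, C c -> nprod (J h) 0 c = 0.
Hypotheses (Cxy : forall n, C (nprod (J x) n (J y))) (Cyx : forall n, C (nprod (J y) n (J x))).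

Let M : set L := sums [set v | exists d, tower (J x) d v \/ tower (J y) d v].

Let hM : subspace M.
Proof.
apply: subspace_sums => c v [d [Tv|Tv]]; exists d; [left|right];
  exact: (subspZ (subspace_tower _ d)).
Qed.

Let Mx : preserves M (J x).
Proof.
move=> n v; apply: (sums_linop (linear_op_mode _ n)) => u [[|d] [Tu|Tu]]; apply: sums1.
- by exists 1%N; left; apply: tower_step.
- by exists 1%N; left; apply/tower_step/tower_base/(tower0 Tu).
- by exists d.+2; left; apply: tower_step.
- by exists d; right; apply: (@tower_opposite y x (-1)).
Qed.

Let My : preserves M (J y).
Proof.
move=> n v; apply: (sums_linop (linear_op_mode _ n)) => u [[|d] [Tu|Tu]]; apply: sums1.
- by exists 1%N; right; apply/tower_step/tower_base/(tower0 Tu).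
- by exists 1%N; right; apply: tower_step.
- by exists d; left; apply: (@tower_opposite x y 1).
- by exists d.+2; right; apply: tower_step.
Qed.

(** The even currents are brackets of x and y, so stability under the two odd currents is enough. *)
Let M_bracket (a b g : osp12 F) (c : F) : c != 0 -> lie_br a b = [:: (c, g)] ->
  preserves M (J a) -> preserves M (J b) -> preserves M (J g).
Proof.
move=> c0 brab Ma Mb n v Mv; have := affine_commutator hJ a b 0 n v.
rewrite brab big_seq1 mul0r if_same scale0r addr0 add0r addrC => /(canLR (addrK _)) E.
have : M (c *: nprod (J g) n v).
  rewrite -E; apply: (subspB hM); first exact/Ma/Mb.
  by apply: (subspZ hM); apply/Mb/Ma.
by move/(subspZ hM c^-1); rewrite scalerA mulVf // scale1r.
Qed.

(** A tower of length [d] over x or y has weight [d] or [- d], so a vector of weight zero comes from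
    length 0, that is, from [C]. *)
Lemma weight0_odd_words v : nprod (J h) 0 v = 0 -> C v.
Proof.
move=> v0; have : M v.
  have : generated_by (range J) v by rewrite gen.
  move: v {v0}; apply: generated_module => [||_ [a _ <-]|_ [a _ <-]].
  - exact: hM.
  - by apply: sums1; exists 0%N; left; apply: tower_base; case: hC.
  - by exists (lie_odd a); apply: hom.
  - case: a => [[]| |] //.
    + by apply: (@M_bracket x x _ 2) => //; rewrite pnatr_eq0.
    + by apply: (@M_bracket y y _ (-2)) => //; rewrite oppr_eq0 pnatr_eq0.
    + by apply: (@M_bracket x y _ 1) => //; rewrite oner_eq0.
case=> r rE Hr; have lin := linear_op_mode (J h) 0.
suff [c Cc Sc] : exists2 c, C c &
    sums [set u | exists2 nu, nu != 0 & eigenvector (nprod (J h) 0) nu u] (v - c).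
  rewrite (@eigenvector_component F L (nprod (J h) 0) 0 v c) //.
    by rewrite /eigenvector v0 scale0r.
  by rewrite /eigenvector C0 // scale0r.
rewrite {}rE {v v0}; elim: r Hr => [|u r IH] Hr.
  by exists 0; [exact: (subsp0 Cs)|rewrite big_nil subr0; apply: sums0].
have [|c Cc Sc] := IH; first by move=> w wr; apply: Hr; rewrite inE wr orbT.
rewrite big_cons.
have nz d t : t != 0 -> (d.+1%:R * t : F) != 0 by move=> t0; rewrite mulf_neq0 // pnatr_eq0.
have [[|d] Tu] := Hr u (mem_head _ _).
  exists (u + c); first by apply: (subspD Cs) => //; case: Tu => /tower0.
  by rewrite opprD addrACA subrr add0r.
exists c => //; rewrite -addrA; apply: sumsD => //; apply: sums1.
case: Tu => Tu.
  by exists (d.+1%:R * 1); [apply: nz; rewrite oner_eq0|exact: (tower_eigenvector (a := x))].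
exists (d.+1%:R * -1); first by apply: nz; rewrite oppr_eq0 oner_eq0.
exact: (tower_eigenvector (a := y)).
Qed.

End OddWords.

Section Parafermions.
Local Notation h := (osp12_even sl2_h).
Local Notation x := osp12_x.
Local Notation y := osp12_y.
Variables (F : numFieldType) (L : vertexSuperalgebra F) (J : osp12 F -> L).
Hypothesis hL : simple_affine (- (3 / 2)) J.

Lemma casimir_eq0 : eval J casimir_expr = 0.
Proof.
have hJ := simple_affine_at_level hL.
have cd : expr_pbw casimir_expr 2 false by vm_compute.
apply: (singular_vector_eq0 hL (@osp12_br_parity F) (@osp12_form_parity F)
  _ (eval_degree hJ cd) (eval_homog hJ cd)) => //.
exact: (casimir_singular hJ).
Qed.

Lemma parafermion_generated :
  parafermion (J h) = generated_by (sl2_parafermion J `|` range (Zvec J)).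
Proof.
have hJ := simple_affine_at_level hL; have hc := casimir_eq0.
have hom := affine_homog hJ; have h_even : homog false (J h) := hom h.
set A := generated_by _.
have hA : vertex_subalgebra A := generated_subalgebra _.
have AN : A `<=` parafermion (J h).
  apply: generated_by_sub => [|v [[_ //]|[i _ <-]]]; last exact: Zvec_parafermion.
  exact: parafermion_subalgebra.
have Ae : A `<=` homog false.
  apply: generated_even => v [[/(sl2_even hJ) //]|[i _ <-]].
  exact: Zvec_even.
have As : sl2_parafermion J `<=` A by move=> v Nv; apply: sub_generated; left.
have AZ i : A (Zvec J i) by apply: sub_generated; right; exists i.
apply/seteqP; split=> // v Nv.
have kappa0 : - (3 / 2) * 2 != 0 :> F.
  by rewrite mulf_eq0 oppr_eq0 mulf_eq0 invr_eq0 !pnatr_eq0.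
have h_ope (n : nat) : nprod (J h) n%:Z (J h) =
    match n with 1%N => (- (3 / 2) * 2) *: vac | _ => 0 end.
  by case: hJ => _ ->; case: n => [|[|n]] //=; rewrite big_nil.
apply: (heis_algebra_parafermion kappa0 h_even h_ope hA Ae AN) => //.
have w0 := sl2_module_weight0 hJ As AN AZ.
have h0 (a : osp12 F) : nprod (J h) 0 (J a) = \sum_(t <- lie_br (h : osp12 F) a) t.1 *: J t.2.
  by case: hJ => _ /(_ h a 0%N).
have [hx hy] : nprod (J h) 0 (J x) = J x /\ nprod (J h) 0 (J y) = - J y.
  by rewrite !h0 /= !big_seq1 scale1r scaleN1r.
apply: (weight0_odd_words hJ (generated_subalgebra _)).
- by apply: sub_generated; left.
- exact: simple_affine_generated hL.
- by move=> c Cc; apply: (heis_algebra_weight0 hJ AN Cc).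
- move=> n; apply: w0; first by case: (odd_products_module hJ hc n).
  by rewrite (even_mode0_derivation _ _ _ h_even) hx hy nprodNr subrr.
- move=> n; apply: w0; first by case: (odd_products_module hJ hc n).
  by rewrite (even_mode0_derivation _ _ _ h_even) hx hy nprodNl addNr.
- exact: (Nv 0%N).
Qed.

End Parafermions.

Theorem theorem8p3 (R : realType)
  (k : R[i]) (hk : k = - (3 / 2))
  (L : vertexSuperalgebra R[i]) (J : osp12 R[i] -> L)
  (hL : simple_affine k J)
  (L0 : vertexSuperalgebra R[i]) (J0 : sl2 R[i] -> L0)
  (hL0 : simple_affine k J0)
  (iota : L0 -> L) (iota_hom : vertex_hom iota) (iota_inj : injective iota)
  (iotaJ : forall a : sl2_basis, iota (J0 a) = J (osp12_even a)) :
  let N := parafermion (J (osp12_even sl2_h)) in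
  let N0 := parafermion (J0 sl2_h) in
  let omega := omega_parafermion k (J0 sl2_e) (J0 sl2_f) (J0 sl2_h) in
  exists Z : 'I_3 -> L,
    [/\ linearly_independent Z,
        forall i, N (Z i),
        forall i, primary (iota omega) 4 (Z i)
      & N = generated_by ((iota @` N0) `|` range Z)].
Proof.
subst k => N N0 omega.
have hJ := simple_affine_at_level hL; have hc := casimir_eq0 hL.
(* The image of [iota] is a vertex subalgebra generated by the even currents, hence it is [V0];
   injectivity is what reflects the equations h(n) v = 0 back to [L0]. *)
have iotaN0 : iota @` N0 = sl2_parafermion J.
  apply/seteqP; split=> [_ [v Nv <-]|v [Vv Nv]].
    split=> [|n]; last by rewrite -iotaJ -(vertex_hom_nprod iota_hom) Nv vertex_hom0.
    have := vertex_hom_generated iota_hom (_ : generated_by (range J0) v).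
    rewrite (simple_affine_generated hL0) => /(_ I).
    apply: sub_smallest2r; first exact: generated_subalgebra.
    by move=> _ [_ [a _ <-] <-]; exists a; rewrite // iotaJ.
  have [w _ wE] : range iota v.
    apply: generated_by_sub Vv => [|_ [a _ <-]]; last by exists (J0 a); rewrite ?iotaJ.
    split; first split.
    - by exists 0; rewrite ?(vertex_hom0 iota_hom).
    - move=> c _ _ [u _ <-] [w _ <-]; exists (c *: u + w) => //.
      by rewrite (vertex_homD iota_hom) (vertex_homZ iota_hom).
    - by exists vac; rewrite ?(vertex_hom_vac iota_hom).
    - move=> _ n _ [u _ <-] [w _ <-]; exists (nprod u n w) => //.
      exact: (vertex_hom_nprod iota_hom).
  exists w => // n; apply: iota_inj.
  by rewrite (vertex_hom_nprod iota_hom) iotaJ wE (vertex_hom0 iota_hom) Nv.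
have iota_omega : iota omega = omega_parafermion (- (3 / 2)) (J (osp12_even sl2_e))
    (J (osp12_even sl2_f)) (J (osp12_even sl2_h)).
  rewrite /omega /omega_parafermion /omega_sug -!iotaJ (vertex_homB iota_hom).
  by rewrite !(vertex_homD iota_hom) !(vertex_homZ iota_hom) !(vertex_hom_nprod iota_hom).
exists (Zvec J); split.
- exact: (Zvec_independent hJ hc (simple_affine_vac_neq0 hL)).
- by move=> i; apply: (Zvec_parafermion hJ hc).
- by move=> i; rewrite iota_omega; apply: (Zvec_primary hJ hc).
- by rewrite iotaN0; apply: (parafermion_generated hL).
Qed.
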